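(* Let $N\in\mathbb N$. Any subgroup $G$ of $\mathcal P_{\le N}$ is a group of global rigidity, that is, given a subgroup $G\subset\mathcal P_{\le N}$, there exist a unitary operator $U\in\mathcal U(\mathcal H)$ on a Hilbert space $\mathcal H$ and an idempotent $p\in\beta\mathbb N$, $p+p=p$, such that $$G=\{P\in\mathcal P_{\le N}:\ p\text{-}\lim_{n\in\mathbb N}U^{P(n)}=Id\}.$$
   Context: $\mathbb N=\{1,2,\dots\}$. $\mathcal P_{\le N}$ is the additive group of polynomials $P\in\mathbb Z[x]$ with $P(0)=0$ and $\deg P\le N$. $\beta\mathbb N$ is the set of ultrafilters on $\mathbb N$, with addition defined by: $A\in p+q$ iff $\{n\in\mathbb N: A-n\in p\}\in q$, where $A-n=\{y\in\mathbb N: y+n\in A\}$. For a sequence $(x_n)$ in a topological space, $p\text{-}\lim_{n\in\mathbb N}x_n=x$ means that $\{n\in\mathbb N: x_n\in O\}\in p$ for every open neighbourhood $O$ of $x$; for bounded operators on a Hilbert space, $p$-limits are taken in the weak operator topology. Hilbert spaces are complex and separable; $\mathcal U(\mathcal H)$ is the group of unitary operators on $\mathcal H$. *)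

(* Defs.v *)
From HB Require Import structures.
From mathcomp Require Import all_boot all_order all_algebra.
From mathcomp Require Import sesquilinear complex.
From mathcomp Require Import all_classical all_reals all_analysis.

Set Implicit Arguments.
Unset Strict Implicit.
Unset Printing Implicit Defensive.

Import Order.TTheory GRing.Theory Num.Theory Num.Def.
Import numFieldNormedType.Exports.

Local Open Scope classical_set_scope.
Local Open Scope ring_scope.

(* The norm is K-valued, hence no square root is needed to tie it to the inner
   product, which is linear in its first argument.  Complex Hilbert spaces are
   the case K := R[i] with R : realType. *)
HB.mixin Record CompleteNormedModule_isHilbert (K : numClosedFieldType) H
    & CompleteNormedModule K H := {
  hdot : {dot H for conjC};
  hdotE : forall x : H, hdot x x = `|x| ^+ 2
}.

#[short(type="hilbertType")]
HB.structure Definition Hilbert (K : numClosedFieldType) :=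
  {H of CompleteNormedModule_isHilbert K H & CompleteNormedModule K H}.

Definition separable (T : topologicalType) : Prop :=
  exists A : set T, countable A /\ dense A.

Section Operators.
Variables (K : numClosedFieldType) (H : hilbertType K).

Record bounded_op := BoundedOp {
  bop_fun :> {linear H -> H};
  bop_bounded : exists M : K, 0 <= M /\ forall x, `|bop_fun x| <= M * `|x|
}.

HB.instance Definition _ := gen_eqMixin bounded_op.
HB.instance Definition _ := gen_choiceMixin bounded_op.

Lemma bop_id_bounded :
  exists M : K, 0 <= M /\ forall x : H, `|(idfun : {linear H -> H}) x| <= M * `|x|.
Proof. by exists 1; split => // x; rewrite mul1r. Qed.

Definition bop_id : bounded_op := BoundedOp bop_id_bounded.

Lemma bop_comp_bounded (S T : bounded_op) :
  exists M : K, 0 <= M /\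
    forall x : H, `|(S \o T : {linear H -> H}) x| <= M * `|x|.
Proof.
have [M [M0 SM]] := bop_bounded S; have [L [L0 TL]] := bop_bounded T.
exists (M * L); split=> [|x]; first exact: mulr_ge0.
by rewrite (le_trans (SM _))// -mulrA ler_wpM2l.
Qed.

Definition bop_comp (S T : bounded_op) : bounded_op :=
  BoundedOp (bop_comp_bounded S T).

Record unitary := Unitary {
  unitary_op :> bounded_op;
  unitary_adj : bounded_op;
  unitary_adjP : forall x y : H,
    hdot (unitary_op x) y = hdot x (unitary_adj y);
  unitary_mulVU : bop_comp unitary_adj unitary_op = bop_id;
  unitary_mulUV : bop_comp unitary_op unitary_adj = bop_id
}.

(* Negative powers use U^(-1) = U^*: Negz n encodes the integer - n.+1. *)
Definition unitary_pow (U : unitary) (k : int) : bounded_op :=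
  match k with
  | Posz n => iter n (bop_comp U) bop_id
  | Negz n => iter n.+1 (bop_comp (unitary_adj U)) bop_id
  end.

Definition matrix_coef (xy : H * H) (T : bounded_op) : K := hdot (T xy.1) xy.2.

(* The weak operator topology is the coarsest one that makes every matrix
   coefficient T |-> <T x, y> continuous. *)
Definition wot : Type :=
  sup_topology (fun xy : H * H =>
    Topological.class (initial_topology (matrix_coef xy))).

HB.instance Definition _ := Topological.on wot.

End Operators.

Arguments bop_id {K H}.
Arguments wot {K} H.

(* The natural numbers start at 1: on nat, the principal ultrafilter at 0 would
   be an additional idempotent. *)
Definition posnat : Type := {n : nat | (0 < n)%N}.

Lemma posnat_add_gt0 (m n : posnat) : (0 < sval m + sval n)%N.
Proof. by rewrite addn_gt0 (svalP m). Qed.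

Definition posnat_add (m n : posnat) : posnat :=
  exist _ (sval m + sval n)%N (posnat_add_gt0 m n).

(* A \in p + q iff {n | A - n \in p} \in q, where A - n = {y | y + n \in A}; note
   the order of p and q, as + is not commutative. *)
Definition uf_add (p q : set_system posnat) : set_system posnat :=
  [set A | q [set n | p [set y | A (posnat_add y n)]]].

(* size P <= N.+1 means deg P <= N. *)
Definition polys_le (N : nat) : set {poly int} :=
  [set P | P.[0] = 0 /\ (size P <= N.+1)%N].

(* Main.v *)
Require Import Defs.
From HB Require Import structures.
From mathcomp Require Import all_boot all_order all_algebra.
From mathcomp Require Import finmap ring lra zify.
From mathcomp Require Import sesquilinear complex.
From mathcomp Require Import all_classical all_reals all_analysis.

Import Order.TTheory GRing.Theory Num.Theory Num.Def.
Import numFieldNormedType.Exports.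

Local Open Scope classical_set_scope.
Local Open Scope ring_scope.

Set Implicit Arguments.
Unset Strict Implicit.
Unset Printing Implicit Defensive.

(** Fix a very lacunary sequence n_0 < n_1 < ... and let the idempotent p contain
all the sets of finite sums of its tails.  For rational numbers t_1, ..., t_N
write <P, t> for the sum of the products of the coefficients of P with t, and
put alpha_l = t_1 / n_l + ... + t_N / n_l^N, so that n_l^j alpha_l is close to
t_j modulo 1 for 1 <= j <= N.  Let U be the multiplication by e(theta), where
e(x) = exp(2 pi i x) and theta is the random sum of the eps_l alpha_l with
independent fair coins eps_l in {0, 1}.  For n a finite sum of the n_k with k in
F, each P(n) alpha_l is, up to an error that decreases geometrically in l, equal
modulo 1 to <P, t> if l is in F and to 0 otherwise ([block_estimate]).  Here the
rationality of t is essential: n_k is divisible by k!, hence by the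
denominators of t for almost all k, and the cross terms in the expansion of a power
of n = n_l + (smaller terms) + (larger terms) only contribute integers and small
errors.  Consequently:

- if <P, t> is an integer, e(P(n) theta) tends to 1 uniformly when n runs through
  the finite sums of further and further tails ([rigid_in]);
- if <P, t> is not an integer, the mean of e(P(n) theta), a product of terms
  (1 + e(P(n) alpha_l)) / 2, has modulus at most |1 + e(<P, t>)| / 2 + o(1),
  which stays away from 1 ([rigid_out]).

The functionals t that are integral on G separate G from every polynomial
outside G ([separation]), because finitely generated abelian groups are
residually finite; there are countably many of them, so that the direct sum over
t of the corresponding unitary operators lives on a separable Hilbert space and
its group of global rigidity along p is G.

The Hilbert space is realised without measure theory.  The Walsh functions,
indexed by finite sets of coins, are an orthonormal basis of the functions of the
coins.  In this basis the multiplication by e(eps_l a) is the combination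
(1 + e(a)) / 2 + (1 - e(a)) / 2 tau_l ([flip]) of the identity and of the
permutation tau_l of the basis that toggles the coin l; U is the norm limit of
the products of these operators ([inf_prod_unitary]).

Finally, p is found among the ultrafilters that contain the filter of finite sums
by a form of Ellis' lemma for filters ([idempotent_ultrafilter]). *)

(** * Limits of complex numbers by coordinates *)

(** All that the analysis below needs to know about the complex numbers K: their real
elements are a copy of a complete ordered field. *)
Record real_form (R : realType) (K : numClosedFieldType) := RealForm {
  ofreal :> {rmorphism R -> K};
  ofreal_le : {mono ofreal : x y / x <= y};
  ofreal_surj : forall z, z \is Num.real -> exists x, z = ofreal x
}.

Section ComplexLimits.
Variables (R : realType) (K : numClosedFieldType) (c : real_form R K).

Definition re (z : K) : R := xget 0 [set x | c x = 'Re z].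
Definition im (z : K) : R := xget 0 [set x | c x = 'Im z].

Lemma ofreal_re z : c (re z) = 'Re z.
Proof.
have [x hx] := ofreal_surj c (Creal_Re z).
by apply: (@xgetPex _ 0 [set x | c x = 'Re z]); exists x.
Qed.

Lemma ofreal_im z : c (im z) = 'Im z.
Proof.
have [x hx] := ofreal_surj c (Creal_Im z).
by apply: (@xgetPex _ 0 [set x | c x = 'Im z]); exists x.
Qed.

Lemma ofreal_lt : {mono c : x y / x < y}.
Proof. exact: leW_mono (ofreal_le c). Qed.

Lemma ofreal_ge0 x : (0 <= c x) = (0 <= x).
Proof. by rewrite -(ofreal_le c) rmorph0. Qed.

Lemma ofreal_gt0 x : (0 < c x) = (0 < x).
Proof. by rewrite -ofreal_lt rmorph0. Qed.

Lemma ofreal_real x : c x \is Num.real.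
Proof.
by rewrite realE ofreal_ge0 -oppr_ge0 -rmorphN ofreal_ge0 oppr_ge0 -realE num_real.
Qed.

Lemma ofreal_norm x : c `|x| = `|c x|.
Proof.
have [x0|x0] := lerP 0 x.
  by rewrite !ger0_norm ?ofreal_ge0.
rewrite ltr0_norm// [RHS]ltr0_norm ?rmorphN//.
by rewrite -oppr_gt0 -rmorphN ofreal_gt0 oppr_gt0.
Qed.

Lemma ofreal_inj : injective c.
Proof. by move=> x y h; apply/eqP; rewrite eq_le -!(ofreal_le c) h lexx. Qed.

Lemma re_ofreal x : re (c x) = x.
Proof. by apply: ofreal_inj; rewrite ofreal_re (Creal_ReP _ _)// ofreal_real. Qed.

Lemma re_rect a b : re (c a + 'i * c b) = a.
Proof. by apply: ofreal_inj; rewrite ofreal_re Re_rect// ofreal_real. Qed.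

Lemma im_rect a b : im (c a + 'i * c b) = b.
Proof. by apply: ofreal_inj; rewrite ofreal_im Im_rect// ofreal_real. Qed.

Lemma reB x y : re (x - y) = re x - re y.
Proof. by apply: ofreal_inj; rewrite rmorphB/= !ofreal_re raddfB. Qed.

Lemma imB x y : im (x - y) = im x - im y.
Proof. by apply: ofreal_inj; rewrite rmorphB/= !ofreal_im raddfB. Qed.

Lemma re_sum (I : Type) (s : seq I) (f : I -> K) :
  re (\sum_(i <- s) f i) = \sum_(i <- s) re (f i).
Proof.
apply: ofreal_inj; rewrite ofreal_re raddf_sum/= rmorph_sum/=.
by apply: eq_bigr => i _; rewrite ofreal_re.
Qed.

Lemma im_sum (I : Type) (s : seq I) (f : I -> K) :
  im (\sum_(i <- s) f i) = \sum_(i <- s) im (f i).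
Proof.
apply: ofreal_inj; rewrite ofreal_im raddf_sum/= rmorph_sum/=.
by apply: eq_bigr => i _; rewrite ofreal_im.
Qed.

Lemma re_le_norm (z : K) : c `|re z| <= `|z|.
Proof. by rewrite ofreal_norm ofreal_re; exact: (leif_normC_Re_Creal z).1. Qed.

Lemma im_le_norm (z : K) : c `|im z| <= `|z|.
Proof.
rewrite ofreal_norm ofreal_im -(ler_pXn2r (n := 2)) ?nnegrE// [leRHS]normC2_Re_Im.
by rewrite real_normK ?Creal_Im// lerDr real_exprn_even_ge0// Creal_Re.
Qed.

Lemma norm_le_reim (z : K) : `|z| <= c (`|re z| + `|im z|).
Proof.
rewrite [X in `|X|]Crect (le_trans (ler_normD _ _))// rmorphD/= !ofreal_norm ofreal_re ofreal_im.
by rewrite lerD// normrM normCi mul1r.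
Qed.

Lemma gt0_ofreal (e : K) : 0 < e -> exists2 r : R, 0 < r & e = c r.
Proof.
move=> e0; have [r hr] := ofreal_surj c (gtr0_real e0); exists r => //.
by move: e0; rewrite hr ofreal_gt0.
Qed.

Section Filter.
Variables (T : Type) (F : set_system T) (FF : Filter F).

Lemma cvg_reim (u : T -> K) (l : K) :
  re (u x) @[x --> F] --> re l ->
  im (u x) @[x --> F] --> im l -> u @ F --> l.
Proof.
move=> /cvgrPdist_lt hr /cvgrPdist_lt hi; apply/cvgrPdist_lt => e /gt0_ofreal[r r0 ->].
have r20 : 0 < r / 2 by rewrite divr_gt0.
near=> x; apply: le_lt_trans (norm_le_reim _) _; rewrite ofreal_lt reB imB [ltRHS]splitr ltrD//.
  by near: x; exact: hr.
by near: x; exact: hi.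
Unshelve. all: by end_near. Qed.

Lemma cvg_re (u : T -> K) (l : K) : u @ F --> l ->
  re (u x) @[x --> F] --> re l.
Proof.
move=> /cvgrPdist_lt hu; apply/cvgrPdist_lt => e e0.
have : 0 < c e by rewrite ofreal_gt0.
move=> /hu; apply: filterS => x /=; rewrite -ofreal_lt; apply: le_lt_trans.
by rewrite -reB; exact: re_le_norm.
Qed.

Lemma cvg_im (u : T -> K) (l : K) : u @ F --> l ->
  im (u x) @[x --> F] --> im l.
Proof.
move=> /cvgrPdist_lt hu; apply/cvgrPdist_lt => e e0.
have : 0 < c e by rewrite ofreal_gt0.
move=> /hu; apply: filterS => x /=; rewrite -ofreal_lt; apply: le_lt_trans.
by rewrite -imB; exact: im_le_norm.
Qed.

Lemma cvg_conj (u : T -> K) (l : K) : u @ F --> l ->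
  (u x)^* @[x --> F] --> l^*.
Proof.
move=> /cvgrPdist_lt hu; apply/cvgrPdist_lt => e /hu; apply: filterS => x.
by rewrite -rmorphB norm_conjC.
Qed.

End Filter.

Lemma le_reim (x y : K) : x <= y -> im x = im y /\ re x <= re y.
Proof.
move=> xy; have : y - x \is Num.real by rewrite ger0_real// subr_ge0.
move=> /[dup] /Creal_ImP h1 /Creal_ReP h2; split.
  by apply/eqP; rewrite eq_sym -subr_eq0 -imB; apply/eqP/ofreal_inj; rewrite ofreal_im h1 rmorph0.
by rewrite -subr_ge0 -reB -(ofreal_le c) ofreal_re h2 rmorph0 subr_ge0.
Qed.

Lemma reim_le (x y : K) : im x = im y -> re x <= re y -> x <= y.
Proof.
move=> hi hr; rewrite (Crect x) (Crect y) -!ofreal_re -!ofreal_im hi lerD2r.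
by rewrite ofreal_le.
Qed.

(** A comparison in K is an equality of imaginary parts together with a comparison of
real parts, and both pass to the limit. *)
Lemma complex_cvg_le T (F : set_system T) (FF : ProperFilter F) (u : T -> K) (l a : K) :
  u @ F --> l -> (\forall x \near F, u x <= a) -> l <= a.
Proof.
move=> ul ua; apply: reim_le.
  have h : (fun=> im a) @ F --> im l.
    apply: cvg_trans (cvg_im _ ul); apply: near_eq_cvg; near=> x.
    have : u x <= a by near: x.
    by move=> /le_reim[].
  apply/eqP; rewrite eq_sym; apply/eqP; apply: (@cvg_unique _ (@Rhausdorff R) _ _ _ _ _ h).
  exact: cvg_cst.
have hr : re (u x) @[x --> F] --> re l by exact: cvg_re.
rewrite -(cvg_lim (@Rhausdorff R) hr).
apply: limr_le; first by apply/cvg_ex; eexists; exact: hr.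
near=> x; have : u x <= a by near: x.
by move=> /le_reim[].
Unshelve. all: by end_near. Qed.

Lemma complex_cvg_ge T (F : set_system T) (FF : ProperFilter F) (u : T -> K) (l a : K) :
  u @ F --> l -> (\forall x \near F, a <= u x) -> a <= l.
Proof.
move=> ul ua; rewrite -lerN2; apply: (@complex_cvg_le _ F _ (fun x => - u x)).
  exact: cvgN.
by near=> x; rewrite /= lerN2; near: x.
Unshelve. all: by end_near. Qed.

End ComplexLimits.

Lemma complex_real_form (R : realType) : real_form R R[i].
Proof.
apply: (@RealForm R R[i] (real_complex R)).
  exact: lecR.
by move=> z /complex_realP[k ->]; exists k.
Qed.

(** * Summation along an exhaustion *)

(** Sums over X are limits of sums over boxes.  With boxes that are eventually
preserved by the permutations of interest, the invariance of the sums under these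
permutations is elementary ([totsum_reindex]). *)
Record exhaustion (X : choiceType) := Exhaustion {
  box :> nat -> {fset X};
  box_mono : forall m n, (m <= n)%N -> (box m `<=` box n)%fset;
  box_cover : forall x, exists n, x \in box n
}.

Section Sums.
Variables (R : realType) (K : numClosedFieldType) (c : real_form R K).
Variables (X : choiceType) (E : exhaustion X).
Implicit Types h : X -> K.

Definition boxsum h (n : nat) : K := \sum_(x <- E n) h x.

Definition abs_summable h : Prop := exists C : K, forall n, boxsum (fun x => `|h x|) n <= C.

Definition totsum h : K := limn (boxsum h).

Lemma boxsum_split (V : zmodType) (f : X -> V) (A B : {fset X}) : (A `<=` B)%fset ->
  \sum_(x <- B) f x = \sum_(x <- A) f x + \sum_(x <- (B `\` A)%fset) f x.
Proof.
move=> AB; rewrite (big_fsetID _ (mem A))/=; congr (_ + _).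
  by apply: eq_fbigl => x; rewrite !inE/= andbC; case: (boolP (x \in A)) => // /(fsubsetP AB) ->.
by apply: eq_fbigl => x; rewrite !inE/= andbC.
Qed.

Lemma boxsum_homo (V : numDomainType) (f : X -> V) m n : (forall x, 0 <= f x) ->
  (m <= n)%N -> \sum_(x <- E m) f x <= \sum_(x <- E n) f x.
Proof.
move=> f0 /(@box_mono _ E) mn; rewrite (boxsum_split _ mn) lerDl.
by rewrite big_seq sumr_ge0.
Qed.

(** A real summand g is the difference of g + |g| and |g|, whose partial sums
increase and are bounded. *)
Lemma abs_summable_cvg h : abs_summable h -> cvgn (boxsum h).
Proof.
move=> [C hC].
have aux (g : X -> R) : (forall x, c `|g x| <= `|h x|) ->
    cvgn (fun n => \sum_(x <- E n) g x).
  move=> gh.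
  have S1 n : (\sum_(x <- E n) `|g x|) <= re c C.
    have /le_trans/(_ (hC n)) : c (\sum_(x <- E n) `|g x|) <= boxsum (fun x => `|h x|) n.
      by rewrite rmorph_sum/=; apply: ler_sum.
    by move=> /(le_reim c)[_]; rewrite re_ofreal.
  have -> : (fun n => \sum_(x <- E n) g x) =
      (fun n => \sum_(x <- E n) (g x + `|g x|)) \- (fun n => \sum_(x <- E n) `|g x|).
    by apply/funext => n /=; rewrite -sumrB; apply: eq_bigr => x _; rewrite addrK.
  apply: is_cvgB.
    apply: nondecreasing_is_cvgn.
      by move=> m n; apply: boxsum_homo => x; rewrite -lerBlDr sub0r lerNnormlW.
    exists (2 * re c C) => _ [n _ <-].
    rewrite big_split/= mulr2n mulrDl mul1r lerD//.
    by apply: le_trans (S1 n); apply: ler_sum => x _; exact: ler_norm.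
  apply: nondecreasing_is_cvgn.
    by move=> m n; apply: boxsum_homo.
  by exists (re c C) => _ [n _ <-].
have /cvg_ex[a ha] := aux (fun x => re c (h x)) (fun x => re_le_norm c (h x)).
have /cvg_ex[b hb] := aux (fun x => im c (h x)) (fun x => im_le_norm c (h x)).
apply/cvg_ex; exists (c a + 'i * c b); apply: (@cvg_reim _ _ c) => /=.
  rewrite re_rect; apply: cvg_trans ha; apply: near_eq_cvg; near=> n.
  by rewrite /boxsum re_sum.
rewrite im_rect; apply: cvg_trans hb; apply: near_eq_cvg; near=> n.
by rewrite /boxsum im_sum.
Unshelve. all: by end_near. Qed.

Lemma abs_summableP h : abs_summable h -> boxsum h @ \oo --> totsum h.
Proof. exact: abs_summable_cvg. Qed.

Lemma totsum_eq h l : boxsum h @ \oo --> l -> totsum h = l.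
Proof. by move=> /cvg_lim; apply; exact: norm_hausdorff. Qed.

Lemma abs_summableD h g : abs_summable h -> abs_summable g -> abs_summable (h + g).
Proof.
move=> [C hC] [D gD]; exists (C + D) => n.
apply: le_trans (lerD (hC n) (gD n)); rewrite /boxsum -big_split/=.
by apply: ler_sum => x _; exact: ler_normD.
Qed.

Lemma abs_summableZ (a : K) h : abs_summable h -> abs_summable (a *: h).
Proof.
move=> [C hC]; exists (`|a| * C) => n.
rewrite (le_trans _ (ler_wpM2l (normr_ge0 a) (hC n)))// /boxsum mulr_sumr.
by apply: ler_sum => x _; rewrite normrM.
Qed.

Lemma abs_summable_le h g : (forall x, `|h x| <= `|g x|) -> abs_summable g -> abs_summable h.
Proof.
by move=> hg [C gC]; exists C => n; apply: le_trans (gC n); apply: ler_sum.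
Qed.

Lemma totsumD h g : abs_summable h -> abs_summable g -> totsum (h + g) = totsum h + totsum g.
Proof.
move=> /abs_summableP hh /abs_summableP hg; apply: totsum_eq.
rewrite (_ : boxsum _ = boxsum h \+ boxsum g); first exact: cvgD.
by apply/funext => n; rewrite /boxsum/= -big_split.
Qed.

Lemma totsumZ (a : K) h : abs_summable h -> totsum (a *: h) = a * totsum h.
Proof.
move=> /abs_summableP hh; apply: totsum_eq.
rewrite (_ : boxsum _ = fun n => a * boxsum h n); first by apply: cvgM hh; exact: cvg_cst.
by apply/funext => n; rewrite /boxsum mulr_sumr.
Qed.

Lemma totsum_conj h : abs_summable h -> totsum (fun x => (h x)^*) = (totsum h)^*.
Proof.
move=> /abs_summableP hh; apply: totsum_eq.
rewrite (_ : boxsum _ = fun n => (boxsum h n)^*); first exact: cvg_conj.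
by apply/funext => n; rewrite /boxsum rmorph_sum.
Qed.

Lemma boxsum_le_totsum h n : (forall x, 0 <= h x) -> abs_summable h -> boxsum h n <= totsum h.
Proof.
move=> h0 /abs_summableP hh; apply: (complex_cvg_ge c _ hh).
by exists n => // m /= nm; apply: boxsum_homo.
Qed.

Lemma totsum_le h C : (forall n, boxsum h n <= C) -> abs_summable h -> totsum h <= C.
Proof.
move=> h0 /abs_summableP hh; apply: (complex_cvg_le c _ hh).
by exists 0%N => // m /= nm; apply: h0.
Qed.

Lemma term_le_totsum h x : (forall x, 0 <= h x) -> abs_summable h -> h x <= totsum h.
Proof.
move=> h0 sh; have [n xn] := box_cover E x.
apply: le_trans (boxsum_le_totsum n h0 sh).
by rewrite /boxsum (big_fsetD1 x)//= lerDl big_seq sumr_ge0.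
Qed.

Lemma boxsum_reindex h (t : X -> X) n : involutive t ->
  (forall x, x \in E n -> t x \in E n) -> boxsum (h \o t) n = boxsum h n.
Proof.
move=> tK tE; rewrite /boxsum -(big_map t xpredT h); apply: perm_big.
apply: uniq_perm; rewrite ?map_inj_uniq ?fset_uniq//; first exact: inv_inj.
move=> x; apply/mapP/idP => [[y yE ->]|xE]; first exact: tE.
by exists (t x); rewrite ?tK//; exact: tE.
Qed.

Section Reindex.
Variables (t : X -> X) (N : nat).
Hypothesis tK : involutive t.
Hypothesis tE : forall n x, (N <= n)%N -> x \in E n -> t x \in E n.

Lemma abs_summable_reindex h : abs_summable h -> abs_summable (h \o t).
Proof.
move=> [C hC]; exists C => n.
apply: le_trans (hC (maxn N n)).
rewrite -(@boxsum_reindex (fun x => `|h x|) t)//; last first.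
  by move=> x; apply: tE; exact: leq_maxl.
by apply: boxsum_homo => //; exact: leq_maxr.
Qed.

Lemma totsum_reindex h : abs_summable h -> totsum (h \o t) = totsum h.
Proof.
move=> /abs_summableP hh; apply: totsum_eq; apply: cvg_trans hh; apply: near_eq_cvg.
by exists N => // n /= Nn; rewrite boxsum_reindex// => x; exact: tE.
Qed.

End Reindex.

End Sums.

(** * The Hilbert space of square-summable families *)

Section Ell2.
Variables (R : realType) (K : numClosedFieldType) (c : real_form R K).
Variables (X : choiceType) (E : exhaustion X).
Implicit Types f g : X -> K.

(** The bound is taken in R: the space thus depends on the real form of K, from which
its topology and its completeness are derived. *)
Definition square_summable f : Prop :=
  exists C : R, forall n, boxsum E (fun x => `|f x| ^+ 2) n <= c C.

Lemma square_summableP f :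
  square_summable f <-> abs_summable E (fun x => `|f x| ^+ 2).
Proof.
have h n : boxsum E (fun x => `| `|f x| ^+ 2|) n = boxsum E (fun x => `|f x| ^+ 2) n.
  by apply: eq_bigr => x _; rewrite ger0_norm// exprn_ge0.
split=> [[C hC]|[C hC]]; first by exists (c C) => n; rewrite h.
exists (re c C) => n; have := hC n; rewrite h => hn.
have r0 : boxsum E (fun x => `|f x| ^+ 2) n \is Num.real.
  by rewrite ger0_real// sumr_ge0// => x _; rewrite exprn_ge0.
have [r hr] := ofreal_surj c r0; rewrite hr in hn *.
by rewrite ofreal_le; have [_] := le_reim c hn; rewrite re_ofreal.
Qed.

Lemma sqr_normD_le (a b : K) : `|a + b| ^+ 2 <= 2 * (`|a| ^+ 2 + `|b| ^+ 2).
Proof.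
have h : 0 <= (`|a| - `|b|) ^+ 2.
  by rewrite real_exprn_even_ge0// rpredB// normr_real.
rewrite (@le_trans _ _ ((`|a| + `|b|) ^+ 2))//.
  by rewrite ler_pXn2r ?nnegrE ?addr_ge0// ler_normD.
rewrite -subr_ge0 (_ : _ - _ = (`|a| - `|b|) ^+ 2)//.
by rewrite sqrrD sqrrB; ring.
Qed.

Lemma norm_mul_le (a b : K) : `|a * b| <= `|a| ^+ 2 + `|b| ^+ 2.
Proof.
have h : 0 <= (`|a| - `|b|) ^+ 2.
  by rewrite real_exprn_even_ge0// rpredB// normr_real.
have h1 : 2 * (`|a| * `|b|) <= `|a| ^+ 2 + `|b| ^+ 2.
  rewrite -subr_ge0 (_ : _ - _ = (`|a| - `|b|) ^+ 2)//.
  by rewrite sqrrB; ring.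
rewrite normrM; apply: le_trans h1.
by rewrite mulr2n mulrDl mul1r lerDl mulr_ge0.
Qed.

Definition ell2_pred : {pred X -> K} := fun f => `[< square_summable f >].

Lemma ell2_predP f : reflect (square_summable f) (f \in ell2_pred).
Proof. exact: asboolP. Qed.

Lemma ell2_pred_sub : submod_closed ell2_pred.
Proof.
split=> [|a f g].
  apply/ell2_predP/square_summableP; exists 0 => n; rewrite /boxsum big1// => x _.
  by rewrite [0 x]/(0 : K) normr0 expr0n normr0.
move=> /ell2_predP/square_summableP[C hC] /ell2_predP/square_summableP[D hD].
apply/ell2_predP/square_summableP.
exists (2 * (`|a| ^+ 2 * C + D)) => n.
apply: (@le_trans _ _ (2 * (`|a| ^+ 2 * boxsum E (fun x => `| `|f x| ^+ 2|) n
    + boxsum E (fun x => `| `|g x| ^+ 2|) n))); last first.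
  by rewrite ler_wpM2l// lerD// ler_wpM2l ?exprn_ge0.
rewrite /boxsum mulr_sumr -big_split mulr_sumr/=; apply: ler_sum => x _.
rewrite !(ger0_norm (exprn_ge0 _ (normr_ge0 _))).
apply: le_trans (sqr_normD_le _ _) _.
by rewrite [(_ *: _) x]/(a * f x) normrM exprMn.
Qed.

HB.instance Definition _ := GRing.isSubmodClosed.Build K (X -> K) ell2_pred ell2_pred_sub.

Record ell2 := Ell2 { ell2_fun :> X -> K ; _ : ell2_fun \in ell2_pred }.

HB.instance Definition _ := [isSub for ell2_fun].
HB.instance Definition _ := [Choice of ell2 by <:].
HB.instance Definition _ := [SubChoice_isSubLmodule of ell2 by <:].

Lemma ell2P (u : ell2) : abs_summable E (fun x => `|u x| ^+ 2).
Proof. by apply/square_summableP; case: u => f /= /ell2_predP. Qed.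

Lemma ell2D (u v : ell2) x : (u + v) x = u x + v x.
Proof. by []. Qed.
Lemma ell2Z a (u : ell2) x : (a *: u) x = a * u x.
Proof. by []. Qed.
Lemma ell2B (u v : ell2) x : (u - v) x = u x - v x.
Proof. by []. Qed.
Lemma ell2_eq (u v : ell2) : (forall x, u x = v x) -> u = v.
Proof. by move=> uv; apply: val_inj; apply/funext. Qed.

Lemma ell2_prod (u v : ell2) : abs_summable E (fun x => u x * (v x)^*).
Proof.
apply: (@abs_summable_le _ _ E _ ((fun x => `|u x| ^+ 2) + (fun x => `|v x| ^+ 2))).
  move=> x; rewrite [X in _ <= `|X|]/(`|u x| ^+ 2 + `|v x| ^+ 2).
  rewrite [leRHS]ger0_norm ?addr_ge0 ?exprn_ge0//.
  by rewrite (le_trans (norm_mul_le _ _))// norm_conjC.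
exact: abs_summableD (ell2P u) (ell2P v).
Qed.

Definition edot (u v : ell2) : K := totsum E (fun x => u x * (v x)^*).

Lemma edot_linearl v : linear_for *%R (edot ^~ v).
Proof.
move=> a u w; rewrite /edot -(totsumZ c)//; last exact: ell2_prod.
rewrite -(totsumD c); [|exact/abs_summableZ/ell2_prod|exact: ell2_prod].
by congr (totsum _ _); apply/funext => x; rewrite ell2D ell2Z mulrDl -mulrA.
Qed.

Lemma edotC u v : edot u v = (edot v u)^*.
Proof.
rewrite /edot -(totsum_conj c); last exact: ell2_prod.
by congr (totsum _ _); apply/funext => x; rewrite /= rmorphM/= conjCK mulrC.
Qed.

Lemma edot_linearr (u : ell2) : linear_for (conjC \; *%R) (edot u).
Proof.
move=> a v w; rewrite edotC edot_linearl rmorphD rmorphM/=.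
by rewrite -!(edotC u).
Qed.

Lemma edotxx (u : ell2) : edot u u = totsum E (fun x => `|u x| ^+ 2).
Proof. by congr (totsum _ _); apply/funext => x; rewrite normCK. Qed.

Lemma edotxx_ge (u : ell2) n : boxsum E (fun x => `|u x| ^+ 2) n <= edot u u.
Proof.
by rewrite edotxx; apply: (boxsum_le_totsum c); [move=> x; rewrite exprn_ge0|exact: ell2P].
Qed.

Lemma edot_term (u : ell2) x : `|u x| ^+ 2 <= edot u u.
Proof.
rewrite edotxx; apply: (@term_le_totsum _ _ c _ _ (fun x => `|u x| ^+ 2)).
  by move=> y; rewrite exprn_ge0.
exact: ell2P.
Qed.

Lemma edot_ge0 (u : ell2) : 0 <= edot u u.
Proof. by apply: le_trans (edotxx_ge u 0); rewrite sumr_ge0// => x _; rewrite exprn_ge0. Qed.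

Lemma edot_eq0 (u : ell2) : edot u u = 0 -> u = 0.
Proof.
move=> u0; apply: ell2_eq => x; have := edot_term u x.
rewrite u0 => h; apply/eqP; rewrite -normr_eq0 -(sqrf_eq0 `|u x|).
by rewrite eq_le h exprn_ge0.
Qed.

Lemma edot_gt0 (u : ell2) : u != 0 -> 0 < edot u u.
Proof.
by move=> u0; rewrite lt0r edot_ge0 andbT; apply: contra_neq u0; exact: edot_eq0.
Qed.

HB.instance Definition _ := bilinear_isBilinear.Build K ell2 ell2 K
  *%R (conjC \; *%R) edot (edot_linearl, edot_linearr).

Lemma edot_hermitian u v : edot u v = (-1) ^+ false * (edot v u)^*.
Proof. by rewrite mul1r edotC. Qed.

HB.instance Definition _ := isHermitianSesquilinear.Build K ell2 false conjC edot
  edot_hermitian.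

HB.instance Definition _ := isDotProduct.Build K ell2 edot edot_gt0.

Definition edot_form : {dot ell2 for conjC} := edot.

End Ell2.

Section DotNorm.
Variables (K : numClosedFieldType) (U : lmodType K) (form : {dot U for conjC}).

Definition dnorm (u : U) : K := sqrtC (form u u).

(** Split u into a multiple of v and a vector orthogonal to v. *)
Lemma dot_CauchySchwarz (u v : U) : `|form u v| <= dnorm u * dnorm v.
Proof.
rewrite /dnorm -sqrtCM ?nnegrE ?dnorm_ge0// -[leLHS](sqrCK (normr_ge0 _)).
rewrite ler_sqrtC ?nnegrE ?exprn_ge0 ?mulr_ge0 ?dnorm_ge0//.
have [->|v0] := eqVneq v 0; first by rewrite linear0r normr0 expr0n/= mulr_ge0 ?dnorm_ge0.
have vv0 : form v v != 0 by rewrite dnorm_eq0.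
pose a := form u v / form v v; pose w := u - a *: v.
have wv : form w v = 0 by rewrite linearBl linearZl_LR/= divfK// subrr.
have -> : form u v = a * form v v by rewrite divfK.
rewrite -[u](subrK (a *: v)) -/w.
have -> : form (w + a *: v) (w + a *: v) = form w w + form (a *: v) (a *: v).
  by rewrite hnormDd// linearZr_LR/= wv mulr0.
rewrite dnormZ normrM exprMn (ger0_norm (dnorm_ge0 _ _)) mulrDl expr2 mulrA -mulrA.
by rewrite mulrA lerDr mulr_ge0 ?dnorm_ge0.
Qed.

Lemma ler_dnormD (u v : U) : dnorm (u + v) <= dnorm u + dnorm v.
Proof.
rewrite -(ler_pXn2r (n := 2)) ?nnegrE ?addr_ge0 ?sqrtC_ge0 ?dnorm_ge0//.
rewrite sqrrD !sqrtCK dnormD [leRHS]addrAC lerD2l.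
have -> : form u v + (form u v)^* = 'Re (form u v) *+ 2.
  by rewrite -[RHS]mulr_natr ReE divfK// pnatr_eq0.
rewrite lerMn2r/=; apply: le_trans (dot_CauchySchwarz u v).
exact: (leif_Re_Creal _).1.
Qed.

Lemma dnormZ_norm (a : K) (u : U) : dnorm (a *: u) = `|a| * dnorm u.
Proof. by rewrite /dnorm dnormZ sqrtCM ?nnegrE ?exprn_ge0 ?dnorm_ge0// sqrCK. Qed.

Lemma dnorm_eq0P (u : U) : dnorm u = 0 -> u = 0.
Proof. by move/eqP; rewrite sqrt_dnorm_eq0 => /eqP. Qed.

End DotNorm.

Section Completeness.
Variables (R : realType) (K : numClosedFieldType) (c : real_form R K).

Lemma complex_complete (F : set_system K) : ProperFilter F -> cauchy F -> cvg F.
Proof.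
move=> FF /cauchyP Fc.
have aux (f : K -> R) : (forall x y, c `|f x - f y| <= `|x - y|) ->
    cvg (f x @[x --> F]).
  move=> fl; apply: cauchy_cvg; apply: cauchy_exP => e e0.
  have /Fc[z Fz] : 0 < c e by rewrite ofreal_gt0.
  exists (f z); suff h : F (fun x => `|f z - f x| < e) by exact: h.
  apply: filterS Fz => x; rewrite -ball_normE/= => zx.
  by rewrite -(ofreal_lt c); exact: le_lt_trans (fl _ _) zx.
have /cvg_ex[a ha] : cvg (re c x @[x --> F]).
  by apply: aux => x y; rewrite -reB; exact: re_le_norm.
have /cvg_ex[b hb] : cvg (im c x @[x --> F]).
  by apply: aux => x y; rewrite -imB; exact: im_le_norm.
apply/cvg_ex; exists (c a + 'i * c b).
by apply: (@cvg_reim _ _ c _ _ _ id); rewrite ?re_rect ?im_rect.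
Qed.

Variables (X : choiceType) (E : exhaustion X).
Local Notation H := (ell2 c E).
Local Notation form := (@edot_form R K c X E).

HB.instance Definition _ := @Lmodule_isNormed.Build K H (dnorm form)
  (ler_dnormD form) (dnormZ_norm form) (@dnorm_eq0P _ _ form).

Lemma ell2_normE (u : H) : `|u| = dnorm form u.
Proof. by []. Qed.

Lemma ell2_norm_sqr (u : H) : edot u u = `|u| ^+ 2.
Proof. by rewrite ell2_normE sqrtCK. Qed.

Lemma ell2_coord_le (u : H) x : `|u x| <= `|u|.
Proof.
by rewrite -(ler_pXn2r (n := 2)) ?nnegrE// -ell2_norm_sqr; exact: edot_term.
Qed.

Lemma ell2_norm_le (u : H) (e : K) : 0 <= e ->
  (forall n, boxsum E (fun x => `|u x| ^+ 2) n <= e ^+ 2) -> `|u| <= e.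
Proof.
move=> e0 h; rewrite -(ler_pXn2r (n := 2)) ?nnegrE// -ell2_norm_sqr edotxx.
exact: (totsum_le c h (ell2P u)).
Qed.

Lemma ell2_boxsum_le (u : H) n : boxsum E (fun x => `|u x| ^+ 2) n <= `|u| ^+ 2.
Proof. by rewrite -ell2_norm_sqr; exact: edotxx_ge. Qed.

Lemma cvg_big_sum (I : choiceType) (s : seq I) (T : Type) (F : set_system T)
    (FF : Filter F) (f : I -> T -> K) (l : I -> K) :
  (forall i, f i @ F --> l i) ->
  (fun t => \sum_(i <- s) f i t) @ F --> \sum_(i <- s) l i.
Proof.
move=> fl; elim: s => [|i s IH].
  rewrite big_nil (_ : (fun _ => _) = fun=> 0); first exact: cvg_cst.
  by apply/funext => t; rewrite big_nil.
rewrite big_cons (_ : (fun _ => _) = fun t => f i t + \sum_(j <- s) f j t).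
  exact: cvgD (fl i) IH.
by apply/funext => t; rewrite big_cons.
Qed.

(** The coordinates of a Cauchy filter converge.  A ball around u0 that belongs to the
filter also contains the coordinatewise limit, since membership can be tested on
the boxes and a finite sum passes to the limit. *)
Lemma ell2_complete (F : set_system H) : ProperFilter F -> cauchy F -> cvg F.
Proof.
move=> FF /cauchyP Fc.
have coord x : exists l : K, (fun u : H => u x) @ F --> l.
  apply/cvg_ex; apply: complex_complete; apply: cauchy_exP => e /Fc[z Fz].
  exists (z x); suff h : F (fun u : H => `|z x - u x| < e).
    by rewrite -ball_normE; exact: h.
  apply: filterS Fz => u; rewrite -ball_normE/= => zu.
  apply: le_lt_trans zu; exact: (ell2_coord_le (z - u) x).
have [g hg] := choice coord.
have close (e : K) (u0 : H) : 0 < e -> F (ball u0 e) -> forall n,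
    boxsum E (fun x => `|g x - u0 x| ^+ 2) n <= e ^+ 2.
  move=> e0 Fu n.
  have hl : (fun u : H => boxsum E (fun x => `|u x - u0 x| ^+ 2) n) @ F -->
      boxsum E (fun x => `|g x - u0 x| ^+ 2) n.
    apply: cvg_big_sum => x.
    have h1 : (fun u : H => `|u x - u0 x|) @ F --> `|g x - u0 x|.
      by apply: cvg_norm; apply: cvgB; [exact: hg|exact: cvg_cst].
    exact: (cvgM h1 h1).
  apply: (complex_cvg_le c _ hl); apply: filterS Fu => u; rewrite -ball_normE/= => h.
  apply: le_trans (ell2_boxsum_le (u - u0) n) _.
  by rewrite ler_pXn2r ?nnegrE ?(ltW e0)// distrC ltW.
have mem (e : K) (u0 : H) : 0 < e -> F (ball u0 e) ->
    exists2 w : H, (forall x, w x = g x - u0 x) & `|w| <= e.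
  move=> e0 Fu; have hc := close e u0 e0 Fu.
  have gP : (fun x => g x - u0 x) \in ell2_pred c E.
    apply/ell2_predP/square_summableP; exists (e ^+ 2) => n.
    apply: le_trans (hc n); apply: ler_sum => x _.
    by rewrite ger0_norm// exprn_ge0.
  by exists (Ell2 gP) => //; apply: ell2_norm_le; rewrite ?ltW.
have [u1 Fu1] := Fc 1 ltr01.
have [w hw _] := mem 1 u1 ltr01 Fu1.
apply/cvg_ex; exists (w + u1); apply/cvgrPdist_lt => e e0.
have e20 : 0 < e / 2 by rewrite divr_gt0.
have [u0 Fu0] := Fc _ e20; have [v hv vn] := mem _ u0 e20 Fu0.
have wv : w + u1 = v + u0 by apply: ell2_eq => x; rewrite !ell2D hw hv !subrK.
rewrite wv; apply: filterS Fu0 => u; rewrite -ball_normE/= => h.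
rewrite -addrA (le_lt_trans (ler_normD _ _))// [ltRHS]splitr.
exact: ler_ltD vn h.
Qed.

HB.instance Definition _ := Uniform_isComplete.Build H ell2_complete.

HB.instance Definition _ := @CompleteNormedModule_isHilbert.Build K H form ell2_norm_sqr.

Definition ell2_hilbert : hilbertType K := H.

End Completeness.

(** * Basis vectors and separability *)

Section Density.
Variables (R : realType) (K : numClosedFieldType) (c : real_form R K).
Variables (X : choiceType) (E : exhaustion X).
Local Notation H := (ell2 c E).

Lemma boxsum_delta_le x n :
  boxsum E (fun y => `|((y == x)%:R : K)| ^+ 2) n <= 1.
Proof.
rewrite /boxsum; have [xn|xn] := boolP (x \in E n).
  rewrite (big_fsetD1 x)//= eqxx normr1 expr1n big_seq big1 ?addr0// => y.
  by rewrite !inE => /andP[/negbTE -> _]; rewrite normr0 expr0n.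
rewrite big_seq big1// => y yn; case: eqVneq => [yx|_]; last by rewrite normr0 expr0n.
by rewrite -yx yn in xn.
Qed.

Lemma delta_mem x : (fun y => (y == x)%:R : K) \in ell2_pred c E.
Proof.
by apply/ell2_predP; exists 1 => n; rewrite rmorph1; exact: boxsum_delta_le.
Qed.

Definition edelta x : H := Ell2 (delta_mem x).

Lemma edeltaE x y : edelta x y = (y == x)%:R. Proof. by []. Qed.

Lemma edelta_norm x : `|edelta x| <= 1.
Proof. by apply: ell2_norm_le => // n; rewrite expr1n; exact: boxsum_delta_le. Qed.

Lemma ell2_sum (I : Type) (s : seq I) (u : I -> H) x :
  (\sum_(i <- s) u i) x = \sum_(i <- s) u i x.
Proof.
elim: s => [|i s IH]; first by rewrite !big_nil.
by rewrite !big_cons ell2D IH.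
Qed.

Definition box_trunc n (u : H) : H := \sum_(x <- E n) u x *: edelta x.

Lemma box_truncE n u x : box_trunc n u x = if x \in E n then u x else 0.
Proof.
rewrite /box_trunc ell2_sum; under eq_bigr do rewrite ell2Z edeltaE.
case: ifPn => xn.
  rewrite (big_fsetD1 x)//= eqxx mulr1 big_seq big1 ?addr0// => y.
  by rewrite !inE eq_sym => /andP[/negbTE -> _]; rewrite mulr0.
rewrite big_seq big1// => y yn; case: eqVneq => [xy|_]; last by rewrite mulr0.
by rewrite xy yn in xn.
Qed.

(** The squared distance from u to its truncation is the remainder of a convergent
series. *)
Lemma box_trunc_approx (u : H) (e : K) : 0 < e -> exists n, `|u - box_trunc n u| < e.
Proof.
move=> e0; have e20 : 0 < e / 2 by rewrite divr_gt0.
have /cvgrPdist_lt/(_ _ (exprn_gt0 2 e20)) [n _ /(_ n (leqnn n)) /= hn] :=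
  abs_summableP c (ell2P u).
exists n; apply: (@le_lt_trans _ _ (e / 2)); last first.
  by rewrite ltr_pdivrMr// mulr2n mulrDr mulr1 ltrDl.
apply: ell2_norm_le => [|m]; first exact: ltW.
set f := fun x => `|u x| ^+ 2.
have f0 x : 0 <= f x by rewrite /f exprn_ge0.
pose M := maxn m n.
apply: (@le_trans _ _ (boxsum E (fun x => `|(u - box_trunc n u) x| ^+ 2) M)).
  by apply: boxsum_homo => [x|]; rewrite ?exprn_ge0// leq_maxl.
have nM : (E n `<=` E M)%fset by apply: box_mono; exact: leq_maxr.
have -> : boxsum E (fun x => `|(u - box_trunc n u) x| ^+ 2) M = boxsum E f M - boxsum E f n.
  rewrite /boxsum !(boxsum_split _ nM) [X in X + _]big_seq big1 => [|x xn].
    rewrite add0r [in RHS]addrC addKr; apply: eq_big_seq => x.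
    by rewrite !inE => /andP[xn _]; rewrite ell2B box_truncE (negbTE xn) subr0.
  by rewrite ell2B box_truncE xn subrr normr0 expr0n.
apply: le_trans (ltW hn); rewrite ger0_norm ?subr_ge0; last first.
  exact: (boxsum_le_totsum c n f0 (ell2P u)).
by rewrite lerD2r; exact: (boxsum_le_totsum c M f0 (ell2P u)).
Qed.

Definition ofrat2 (q : rat * rat) : K := c (ratr q.1) + 'i * c (ratr q.2).

Lemma ofrat2_dense (z e : K) : 0 < e -> exists q, `|z - ofrat2 q| < e.
Proof.
move=> /(gt0_ofreal c)[r r0 ->].
have r20 : 0 < r / 2 by rewrite divr_gt0.
have aux (a : R) : exists q : rat, `|a - ratr q| < r / 2.
  have [|q] := @rat_in_itvoo _ (a - r / 2) (a + r / 2).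
    by rewrite ltrBlDr -addrA ltrDl addr_gt0.
  by rewrite in_itv/= => h; exists q; rewrite distrC ltr_distl.
have [q1 h1] := aux (re c z); have [q2 h2] := aux (im c z).
exists (q1, q2); apply: le_lt_trans (norm_le_reim c _) _; rewrite ofreal_lt.
by rewrite reB imB re_rect im_rect [ltRHS]splitr ltrD.
Qed.

Lemma ell2_separable : separable (ell2_hilbert c E).
Proof.
(* The countable family: rational coordinates are listed along the enumeration of
   a box. *)
pose f (p : nat * seq (rat * rat)) : H :=
  \sum_(x <- E p.1) ofrat2 (nth (0, 0) p.2 (index x (E p.1))) *: edelta x.
exists (range f); split; first exact: (card_le_trans (card_image_le _ _) (countableP _)).
move=> O [u Ou] oO; have := open_nbhs_nbhs (conj oO Ou).
move=> /nbhs_ballP[e e0]; rewrite -ball_normE => eO.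
have e20 : 0 < e / 2 by rewrite divr_gt0.
have [n hn] := box_trunc_approx u e20.
pose d := e / 2 / (size (E n)).+1%:R.
have d0 : 0 < d by rewrite divr_gt0// ltr0n.
have [q hq] := choice (fun x => ofrat2_dense (u x) d0).
exists (f (n, [seq q x | x <- E n])); split; last by exists (n, [seq q x | x <- E n]).
apply: eO => /=; rewrite -[u](subrK (box_trunc n u)) -addrA.
rewrite (le_lt_trans (ler_normD _ _))// [ltRHS]splitr; apply: ltr_leD => //.
have -> : box_trunc n u - f (n, [seq q x | x <- E n]) =
    \sum_(x <- E n) (u x - ofrat2 (q x)) *: edelta x.
  rewrite /box_trunc /f /= -sumrB; apply: eq_big_seq => x xn.
  by rewrite scalerBl (nth_map x) ?index_mem// nth_index.
apply: le_trans (ler_norm_sum _ _ _) _.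
apply: (@le_trans _ _ (\sum_(x <- E n) d)).
  apply: ler_sum => x _; rewrite normrZ -[leRHS]mulr1 ler_pM//.
    exact: ltW (hq x).
  exact: edelta_norm.
rewrite big_const_seq count_predT iter_addr_0 -[leLHS]mulr_natr /d.
rewrite -[leRHS]mulr1 -[leLHS]mulrA ler_wpM2l ?(ltW e20)//.
by rewrite mulrC ler_pdivrMr ?ltr0n// mul1r ler_nat.
Qed.

End Density.

(** * The character exp(2 pi i x) *)

Section Phase.
Variables (R : realType) (K : numClosedFieldType) (c : real_form R K).

Definition turn (x : R) : R := pi *+ 2 * x.

Definition phase (x : R) : K := c (cos (turn x)) + 'i * c (sin (turn x)).

Lemma phase0 : phase 0 = 1.
Proof. by rewrite /phase /turn mulr0 cos0 sin0 rmorph0 mulr0 addr0 rmorph1. Qed.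

Lemma phaseD x y : phase (x + y) = phase x * phase y.
Proof.
rewrite /phase /turn mulrDr cosD sinD rmorphB rmorphD !rmorphM/=.
set a := c _; set b := c _; set a' := c _; set b' := c _.
have hi : 'i * 'i = -1 :> K by rewrite -expr2 sqrCi.
transitivity (a' * b + ('i * 'i) * (a * b') + 'i * (a * b + a' * b')).
  by rewrite hi mulN1r.
by ring.
Qed.

Lemma phase_norm x : `|phase x| = 1.
Proof.
apply/eqP; rewrite -(eqrXn2 (n := 2))// ?normC2_rect ?ofreal_real//.
by rewrite -!rmorphXn -rmorphD/= cos2Dsin2 rmorph1 expr1n.
Qed.

Lemma phaseN x : phase (- x) = (phase x)^*.
Proof.
rewrite /phase /turn mulrN cosN sinN rmorphN rmorphD rmorphM/= conjCi mulrN mulNr.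
by rewrite !conj_Creal ?ofreal_real.
Qed.

Lemma phase_int (k : int) : phase k%:~R = 1.
Proof.
have h1 : phase 1 = 1 by rewrite /phase /turn mulr1 cos2pi sin2pi rmorph0 mulr0 addr0 rmorph1.
have hn (n : nat) : phase n%:R = 1.
  by elim: n => [|n IH]; rewrite ?phase0// -natr1 phaseD IH h1 mulr1.
case: k => n; first exact: hn.
by rewrite NegzE rmorphN/= phaseN [_%:~R]/(n.+1%:R) hn conjC1.
Qed.

Lemma phaseD_int x (k : int) : phase (x + k%:~R) = phase x.
Proof. by rewrite phaseD phase_int mulr1. Qed.

Lemma MVT_lipschitz (f df : R -> R) (x : R) :
  (forall y : R, is_derive y (1 : R) f (df y)) -> (forall y, `|df y| <= 1) ->
  `|f x - f 0| <= `|x|.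
Proof.
move=> fd db.
have fc : continuous f.
  by move=> y; apply: differentiable_continuous; apply/derivable1_diffP; have [] := fd y.
have [x0|x0] := lerP 0 x.
  have [|y _ ->] := @MVT_segment R f df 0 x x0 (fun y _ => fd y).
    exact: continuous_subspaceT.
  by rewrite subr0 normrM ler_piMl.
have [|y _ h] := @MVT_segment R f df x 0 (ltW x0) (fun y _ => fd y).
  exact: continuous_subspaceT.
by rewrite distrC h sub0r normrM normrN ler_piMl.
Qed.

Lemma phase_lipschitz x : `|phase x - 1| <= c (pi *+ 4 * `|x|).
Proof.
have h1 : `|cos (turn x) - 1| <= `|turn x|.
  rewrite -[X in _ - X]cos0; apply: (@MVT_lipschitz cos (fun y => - sin y)).
  by move=> y; rewrite normrN ler_norml sin_geN1 sin_le1.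
have h2 : `|sin (turn x)| <= `|turn x|.
  rewrite -[X in `|X|]subr0 -[X in _ - X]sin0; apply: (@MVT_lipschitz sin cos).
  by move=> y; rewrite ler_norml cos_geN1 cos_le1.
apply: le_trans (norm_le_reim c _) _; rewrite ofreal_le.
have -> : phase x - 1 = c (cos (turn x) - 1) + 'i * c (sin (turn x)).
  by rewrite rmorphB rmorph1/= addrAC.
rewrite re_rect im_rect.
apply: le_trans (lerD h1 h2) _.
rewrite normrM (ger0_norm (mulrn_wge0 2 (pi_ge0 R))).
by rewrite -mulrDl -mulrnDr.
Qed.

(** If f is the fractional part of x then cos (2 pi f) = 1 - 2 sin (pi f)^2, and the
sine is positive for 0 < f < 1. *)
Lemma phase_eq1 x : phase x = 1 -> exists k : int, x = k%:~R.
Proof.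
move=> h; pose k := Num.floor x; exists k; pose f := x - k%:~R.
have fx : x = f + k%:~R by rewrite subrK.
have f0 : 0 <= f by rewrite subr_ge0 floor_le.
have f1 : f < 1 by rewrite ltrBlDr addrC -[X in _ + X]/(1%:~R) -intrD floorD1_gt.
have [f00|fpos] := eqVneq f 0; first by rewrite fx f00 add0r.
exfalso; move: h; rewrite fx phaseD_int => h.
have : cos (turn f) = 1.
  by have := congr1 (re c) h; rewrite -(rmorph1 c) re_ofreal re_rect.
have -> : turn f = (pi * f) *+ 2 by rewrite /turn mulrnAl.
rewrite cos_mulr2n cos2sin2 => h2.
have : sin (pi * f) != 0.
  apply/lt0r_neq0/sin_gt0_pi; apply/andP; split.
    by rewrite mulr_gt0 ?pi_gt0// lt_def fpos.
  by rewrite gtr_pMr// pi_gt0.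
rewrite -sqrf_eq0 => /eqP; apply.
by lra.
Qed.

End Phase.

(** * Flip operators *)

Section Flips.
Variables (R : realType) (K : numClosedFieldType) (c : real_form R K).
Variables (X : choiceType) (E : exhaustion X).
Local Notation H := (ell2 c E).
Local Notation phase := (phase c).
Variable t : nat -> X -> X.
Hypothesis tK : forall l, involutive (t l).
Hypothesis tC : forall l m x, t l (t m x) = t m (t l x).
Hypothesis tE : forall l n x, (l < n)%N -> x \in E n -> t l x \in E n.

Implicit Types (a b : X -> R) (u v : H) (l m n : nat).

Definition halfsum (z : K) : K := (1 + z) / 2.
Definition halfdiff (z : K) : K := (1 - z) / 2.

Lemma halfsum_le z : `|z| = 1 -> `|halfsum z| <= 1.
Proof.
move=> z1; rewrite normrM normfV (ger0_norm (ler0n K 2)) ler_pdivrMr// mul1r.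
by rewrite (le_trans (ler_normD _ _))// normr1 z1.
Qed.

Lemma halfdiff_le z : `|z| = 1 -> `|halfdiff z| <= 1.
Proof.
by move=> z1; rewrite /halfdiff -[1 - z]/(1 + - z) halfsum_le// normrN.
Qed.

(** If the involution t l describes the multiplication by a sign r in a basis of
functions, this is the multiplication by the function equal to 1 where r = 1 and to
phase a where r = -1; a may vary with the basis vector, but not along the orbits of
t l. *)
Definition flip_fun l a (u : X -> K) x : K :=
  halfsum (phase (a x)) * u x + halfdiff (phase (a x)) * u (t l x).

Lemma ecomp_mem l u : (u \o t l) \in ell2_pred c E.
Proof.
apply/ell2_predP/square_summableP.
exact: (abs_summable_reindex (@tK l) (fun n x (h : (l.+1 <= n)%N) => tE h) (ell2P u)).
Qed.

Definition ecomp l u : H := Ell2 (ecomp_mem l u).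

Lemma ecompE l u x : ecomp l u x = u (t l x). Proof. by []. Qed.

Lemma flip_mem l a u : flip_fun l a u \in ell2_pred c E.
Proof.
apply/ell2_predP/square_summableP.
apply: (@abs_summable_le _ _ E _
  ((2 : K) *: ((fun x => `|u x| ^+ 2) + (fun x => `|ecomp l u x| ^+ 2)))).
  move=> x; rewrite [X in _ <= `|X|]/(2 * (`|u x| ^+ 2 + `|u (t l x)| ^+ 2)).
  rewrite [leLHS]ger0_norm ?exprn_ge0// [leRHS]ger0_norm; last first.
    by rewrite mulr_ge0// addr_ge0 ?exprn_ge0.
  rewrite /flip_fun; apply: le_trans (sqr_normD_le _ _) _; rewrite ler_wpM2l//.
  apply: lerD; rewrite ler_pXn2r ?nnegrE// normrM; apply: ler_piMl => //.
    by rewrite halfsum_le// phase_norm.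
  by rewrite halfdiff_le// phase_norm.
exact/abs_summableZ/abs_summableD/ell2P/ell2P.
Qed.

Definition flip l a u : H := Ell2 (flip_mem l a u).

Lemma flipE l a u x : flip l a u x =
  halfsum (phase (a x)) * u x + halfdiff (phase (a x)) * u (t l x).
Proof. by []. Qed.

Lemma flip_linear l a : linear (flip l a).
Proof.
move=> k u v; apply: ell2_eq => x.
by rewrite ell2D ell2Z !flipE !ell2D !ell2Z; ring.
Qed.

Lemma ell2_norm_pointwise u v (M : K) : 0 <= M ->
  (forall x, `|u x| <= M * `|v x|) -> `|u| <= M * `|v|.
Proof.
move=> M0 h; apply: ell2_norm_le => [|n]; first exact: mulr_ge0.
rewrite exprMn; apply: le_trans (ler_wpM2l (exprn_ge0 2 M0) (ell2_boxsum_le v n)).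
rewrite /boxsum mulr_sumr; apply: ler_sum => x _.
by rewrite -exprMn ler_pXn2r ?nnegrE ?mulr_ge0.
Qed.

Lemma ecomp_norm l u : `|ecomp l u| = `|u|.
Proof.
apply/eqP; rewrite -(eqrXn2 (n := 2))// -!ell2_norm_sqr !edotxx; apply/eqP.
exact: (totsum_reindex c (@tK l) (fun n x (h : (l.+1 <= n)%N) => tE h) (ell2P u)).
Qed.

Lemma flip0 l u : flip l (fun=> 0) u = u.
Proof.
apply: ell2_eq => x; rewrite flipE phase0 /halfsum /halfdiff subrr mul0r mul0r addr0.
by rewrite -mulr2n divff ?mul1r// pnatr_eq0.
Qed.

Lemma flipD l a b u : (forall x, a (t l x) = a x) -> (forall x, b (t l x) = b x) ->
  flip l (a \+ b) u = flip l a (flip l b u).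
Proof.
move=> ha hb; apply: ell2_eq => x; rewrite !flipE phaseD hb (@tK l).
by rewrite /halfsum /halfdiff; field.
Qed.

Lemma flipC l m a b u : (forall x, a (t m x) = a x) -> (forall x, b (t l x) = b x) ->
  flip l a (flip m b u) = flip m b (flip l a u).
Proof.
move=> ha hb; apply: ell2_eq => x; rewrite !flipE ha hb (tC l m).
by ring.
Qed.

(** Permuting the summation indices by t l moves the permutation from u to v. *)
Lemma flip_adj l a u v : (forall x, a (t l x) = a x) ->
  edot (flip l a u) v = edot u (flip l (fun x => - a x) v).
Proof.
move=> ha; rewrite /edot.
pose p x := halfsum (phase (a x)); pose q x := halfdiff (phase (a x)).
have s1 : abs_summable E (fun x => p x * (u x * (v x)^*)).
  apply: (abs_summable_le _ (ell2_prod u v)) => x.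
  by rewrite normrM ler_piMl// halfsum_le// phase_norm.
have s2 : abs_summable E (fun x => q x * (u x * (ecomp l v x)^*)).
  apply: (abs_summable_le _ (ell2_prod u (ecomp l v))) => x.
  by rewrite normrM ler_piMl// halfdiff_le// phase_norm.
have tl : forall n x, (l.+1 <= n)%N -> x \in E n -> t l x \in E n.
  by move=> n x; exact: tE.
transitivity (totsum E (fun x => p x * (u x * (v x)^*)) +
              totsum E (fun x => q x * (u x * (ecomp l v x)^*))).
  rewrite -[X in _ + X](totsum_reindex c (@tK l) tl s2).
  rewrite -(totsumD c s1 (abs_summable_reindex (@tK l) tl s2)).
  congr (totsum _ _); apply/funext => x.
  by rewrite [RHS]/(_ + _) /= /flip_fun /q ha (@tK l) mulrDl !mulrA.
rewrite -(totsumD c s1 s2); congr (totsum _ _); apply/funext => x.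
have conjE (z y y' : K) : (halfsum z^* * y + halfdiff z^* * y')^* =
    halfsum z * y^* + halfdiff z * y'^*.
  rewrite /halfsum /halfdiff rmorphD !rmorphM/= !fmorphV rmorphD rmorphB/=.
  by rewrite conjCK !rmorph1 !rmorph_nat.
rewrite [LHS]/(_ + _) flipE /p /q ecompE/= phaseN conjE.
by rewrite mulrDr; congr (_ + _); rewrite mulrCA.
Qed.

Lemma flip_norm l a u : (forall x, a (t l x) = a x) -> `|flip l a u| = `|u|.
Proof.
move=> ha; apply/eqP; rewrite -(eqrXn2 (n := 2))// -!ell2_norm_sqr; apply/eqP.
rewrite flip_adj// -flipD//; last by move=> x; rewrite ha.
congr edot; rewrite -[RHS](flip0 l); congr flip; apply/funext => x /=.
by rewrite addNr.
Qed.

(** Only the values of a on the support of u matter, so that the estimate can be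
applied to one summand of a direct sum at a time. *)
Lemma flip_near l a u (e : K) : 0 <= e ->
  (forall x, u x != 0 \/ u (t l x) != 0 -> `|phase (a x) - 1| <= e) ->
  `|flip l a u - u| <= e * `|u|.
Proof.
move=> e0 h.
have -> : e * `|u| = e / 2 * (`|u| + `|ecomp l u|).
  by rewrite ecomp_norm; field.
apply: (@le_trans _ _ (e / 2 * `|u - ecomp l u|)); last first.
  by rewrite ler_wpM2l ?divr_ge0// ler_normB.
apply: ell2_norm_pointwise => [|x]; first by rewrite divr_ge0.
have -> : (flip l a u - u) x = (phase (a x) - 1) / 2 * (u - ecomp l u) x.
  by rewrite !ell2B flipE ecompE /halfsum /halfdiff; field.
rewrite normrM normrM normfV (ger0_norm (ler0n K 2)).
have [->|ne] := eqVneq ((u - ecomp l u) x) 0; first by rewrite normr0 !mulr0.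
rewrite ler_wpM2r// ler_pM2r ?invr_gt0//; apply: h.
have [u0|] := eqVneq (u x) 0; last by left.
right; apply: contra_neq ne => u1.
by rewrite ell2B ecompE u0 u1 subrr.
Qed.

End Flips.

(** * Infinite products of flip operators *)

Section GeometricConvergence.
Variables (R : realType) (K : numClosedFieldType) (c : real_form R K).

Lemma half_pow_lt (D e : K) : 0 <= D -> 0 < e ->
  exists N, forall n, (N <= n)%N -> D * 2^-1 ^+ n < e.
Proof.
move=> D0 /(gt0_ofreal c)[r r0 ->].
have [s ->] := ofreal_surj c (ger0_real D0).
have [N hN] : exists N : nat, s / r < N%:R.
  exists (Num.bound `|s / r|); apply: le_lt_trans (ler_norm _) _; exact: archi_boundP.
exists N => n Nn; rewrite exprVn -(rmorph_nat c 2) -rmorphXn -fmorphV -rmorphM/= ofreal_lt.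
rewrite ltr_pdivrMr ?exprn_gt0// mulrC -ltr_pdivrMr//; apply: lt_trans hN _.
by rewrite -natrX ltr_nat (leq_ltn_trans Nn)// ltn_expl.
Qed.

Lemma geometric_tail (V : normedModType K) (v : nat -> V) (D : K) :
  (forall n, `|v n.+1 - v n| <= D * 2^-1 ^+ n) ->
  forall m n, (n <= m)%N -> `|v m - v n| <= 2 * D * 2^-1 ^+ n.
Proof.
move=> hv m n /subnKC <-.
have D0 : 0 <= D by have := hv 0%N; rewrite expr0 mulr1; apply: le_trans.
apply: (@le_trans _ _ (2 * D * (2^-1 ^+ n - 2^-1 ^+ (n + (m - n))))); last first.
  by rewrite ler_wpM2l ?mulr_ge0// gerBl exprn_ge0 ?invr_ge0.
elim: (m - n)%N => [|k IH]; first by rewrite addn0 !subrr normr0 mulr0.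
rewrite addnS -[v _ - _](subrKA (v (n + k)%N)) (le_trans (ler_normD _ _))//.
apply: le_trans (lerD (hv _) IH) _; rewrite exprS le_eqVlt; apply/orP; left; apply/eqP.
by field.
Qed.

Lemma geometric_cvg (V : completeNormedModType K) (v : nat -> V) (D : K) :
  (forall n, `|v n.+1 - v n| <= D * 2^-1 ^+ n) -> cvgn v.
Proof.
move=> hv; have D0 : 0 <= D by have := hv 0%N; rewrite expr0 mulr1; apply: le_trans.
apply: cauchy_cvg; apply: cauchy_exP => e e0.
have [|N hN] := @half_pow_lt (2 * D) e _ e0; first by rewrite mulr_ge0.
exists (v N); exists N => // n /= Nn; rewrite -ball_normE/= distrC.
exact: le_lt_trans (geometric_tail hv Nn) (hN _ (leqnn N)).
Qed.

End GeometricConvergence.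

Section HdotContinuity.
Variables (K : numClosedFieldType) (H : hilbertType K).

Lemma hdot_CauchySchwarz (u v : H) : `|hdot u v| <= `|u| * `|v|.
Proof.
have := dot_CauchySchwarz (@hdot K H) u v.
by rewrite /dnorm !hdotE !sqrCK.
Qed.

Lemma hdotC (u v : H) : hdot u v = (hdot v u)^*.
Proof. by rewrite hermC mul1r. Qed.

Lemma hdotBl (u v w : H) : hdot (u - v) w = hdot u w - hdot v w.
Proof. exact: linearBl. Qed.

Section Filter.
Variables (T : Type) (F : set_system T) (FF : Filter F).

Lemma hdot_cvgl (u : T -> H) (l v : H) : u @ F --> l ->
  (fun x => hdot (u x) v) @ F --> hdot l v.
Proof.
move=> /cvgrPdist_lt ul; apply/cvgrPdist_lt => e e0.
have v0 : 0 < `|v| + 1 by rewrite ltr_wpDl.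
have /ul : 0 < e / (`|v| + 1) by rewrite divr_gt0.
apply: filterS => x; rewrite ltr_pdivlMr// => h.
rewrite -hdotBl (le_lt_trans (hdot_CauchySchwarz _ _))//.
by apply: le_lt_trans h; rewrite ler_wpM2l// lerDl.
Qed.

Lemma hdot_cvgr (u : T -> H) (l v : H) : u @ F --> l ->
  (fun x => hdot v (u x)) @ F --> hdot v l.
Proof.
move=> ul; rewrite hdotC.
have -> : (fun x => hdot v (u x)) = (fun x => (hdot (u x) v)^*).
  by apply/funext => x; rewrite hdotC.
by apply: cvg_conj; exact: hdot_cvgl.
Qed.

End Filter.
End HdotContinuity.

Section Product.
Variables (R : realType) (K : numClosedFieldType) (c : real_form R K).
Variables (X : choiceType) (E : exhaustion X).
Local Notation H := (ell2_hilbert c E).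
Local Notation phase := (phase c).
Variable t : nat -> X -> X.
Hypothesis tK : forall l, involutive (t l).
Hypothesis tC : forall l m x, t l (t m x) = t m (t l x).
Hypothesis tE : forall l n x, (l < n)%N -> x \in E n -> t l x \in E n.

Local Notation flip := (flip tK tE).
Implicit Types (th : nat -> X -> R) (u v : H).

Fixpoint partial_prod th n (u : H) : H :=
  if n is n'.+1 then flip n' (th n') (partial_prod th n' u) else u.

Definition flip_invariant th : Prop := forall l m x, th l (t m x) = th l x.

(** The decay is uniform in the basis vector: the partial products then converge in
norm. *)
Definition rapid th : Prop :=
  exists2 D : K, 0 <= D & forall l x, `|phase (th l x) - 1| <= D * 2^-1 ^+ l.

Lemma partial_prod_linear th n : linear (partial_prod th n).
Proof. by elim: n => [//|n IH] k u v /=; rewrite IH flip_linear. Qed.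

Lemma partial_prod_norm th n u : flip_invariant th -> `|partial_prod th n u| = `|u|.
Proof.
move=> ti; elim: n => [//|n IH] /=; rewrite -IH; apply: flip_norm => x.
exact: ti.
Qed.

Lemma partial_prodB th n u v :
  partial_prod th n (u - v) = partial_prod th n u - partial_prod th n v.
Proof.
by rewrite addrC -scaleN1r partial_prod_linear scaleN1r addrC.
Qed.

Lemma flip_partial_prod th n l a u : flip_invariant th ->
  (forall m x, a (t m x) = a x) ->
  flip l a (partial_prod th n u) = partial_prod th n (flip l a u).
Proof.
move=> ti ta; elim: n => [//|n IH] /=; rewrite -IH; by apply: flipC.
Qed.

Lemma partial_prodD th th' n u : flip_invariant th -> flip_invariant th' ->
  partial_prod (fun l => th l \+ th' l) n u = partial_prod th n (partial_prod th' n u).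
Proof.
move=> ti ti'; elim: n => [//|n IH] /=; rewrite flipD// IH flip_partial_prod//.
Qed.

Lemma partial_prod0 n u : partial_prod (fun _ _ => 0) n u = u.
Proof. by elim: n => [//|n IH] /=; rewrite IH flip0. Qed.

Definition opp_phases th l x : R := - th l x.

Lemma opp_phases_invariant th : flip_invariant th -> flip_invariant (opp_phases th).
Proof. by move=> ti l m x; rewrite /opp_phases ti. Qed.

Lemma opp_phases_rapid th : rapid th -> rapid (opp_phases th).
Proof.
move=> [D D0 hD]; exists D => // l x; rewrite /opp_phases phaseN -norm_conjC.
by rewrite rmorphB/= conjCK rmorph1.
Qed.

Lemma opp_phasesK th : opp_phases (opp_phases th) = th.
Proof. by apply/funext => l; apply/funext => x; rewrite /opp_phases opprK. Qed.

Lemma partial_prodK th n u : flip_invariant th ->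
  partial_prod (opp_phases th) n (partial_prod th n u) = u.
Proof.
move=> ti; rewrite -partial_prodD//; last exact: opp_phases_invariant.
rewrite -[RHS](partial_prod0 n); congr partial_prod.
by apply/funext => l; apply/funext => x; rewrite /= /opp_phases addNr.
Qed.

Lemma partial_prod_adj th n u v : flip_invariant th ->
  hdot (partial_prod th n u) v = hdot u (partial_prod (opp_phases th) n v).
Proof.
move=> ti; elim: n u v => [//|n IH] u v /=.
rewrite -[LHS]/(edot _ _) flip_adj//.
rewrite -[LHS]/(hdot (partial_prod th n u) _) IH flip_partial_prod//.
  exact: opp_phases_invariant.
by move=> m x; rewrite /opp_phases ti.
Qed.

Lemma partial_prod_cvg th u : flip_invariant th -> rapid th ->
  cvgn (fun n => partial_prod th n u).
Proof.
move=> ti [D D0 hD]; apply: (@geometric_cvg R K c _ _ (D * `|u|)) => n /=.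
rewrite mulrAC -(partial_prod_norm n u ti).
apply: flip_near => [|x _]; last exact: hD.
by rewrite mulr_ge0// exprn_ge0// invr_ge0.
Qed.

Record good_phases := GoodPhases {
  phases :> nat -> X -> R;
  phases_invariant : flip_invariant phases;
  phases_rapid : rapid phases
}.

Definition good_opp (g : good_phases) : good_phases :=
  GoodPhases (opp_phases_invariant (phases_invariant g)) (opp_phases_rapid (phases_rapid g)).

Implicit Types (g : good_phases).

Definition inf_prod g (u : H) : H := limn (fun n => partial_prod g n u).

Lemma inf_prod_cvg g u : (fun n => partial_prod g n u) @ \oo --> inf_prod g u.
Proof. exact: (partial_prod_cvg (phases_invariant g) (phases_rapid g)). Qed.

Lemma inf_prod_eq g u v : (fun n => partial_prod g n u) @ \oo --> v -> inf_prod g u = v.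
Proof. by move=> /cvg_lim; apply; exact: norm_hausdorff. Qed.

Lemma inf_prod_linear g : linear (inf_prod g).
Proof.
move=> k u v; apply: inf_prod_eq.
have -> : (fun n => partial_prod g n (k *: u + v)) =
    (fun n => k *: partial_prod g n u + partial_prod g n v).
  by apply/funext => n; rewrite partial_prod_linear.
by apply: cvgD; [apply: cvgZr|]; exact: inf_prod_cvg.
Qed.

HB.instance Definition _ g := GRing.isLinear.Build K H H *:%R (inf_prod g) (inf_prod_linear g).

(** The partial products are isometric, hence equicontinuous. *)
Lemma partial_prod_cvg_seq g (w : nat -> H) v : w @ \oo --> v ->
  (fun n => partial_prod g n (w n)) @ \oo --> inf_prod g v.
Proof.
move=> wv.
have -> : (fun n => partial_prod g n (w n)) =
    (fun n => partial_prod g n (w n - v) + partial_prod g n v).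
  by apply/funext => n; rewrite partial_prodB subrK.
rewrite -[X in _ --> X]add0r; apply: cvgD; last exact: inf_prod_cvg.
apply/cvgrPdist_lt => e e0; move/cvgrPdist_lt : wv => /(_ e e0); apply: filterS => n.
rewrite sub0r normrN (partial_prod_norm _ _ (phases_invariant g)).
by rewrite -normrN opprB.
Qed.

Lemma inf_prod_norm g u : `|inf_prod g u| = `|u|.
Proof.
have h : (fun n => `|partial_prod g n u|) @ \oo --> `|inf_prod g u|.
  by apply: cvg_norm; exact: inf_prod_cvg.
apply: (@cvg_unique K (@norm_hausdorff _ _) _ _ _ _ h).
have -> : (fun n => `|partial_prod g n u|) = fun=> `|u|.
  by apply/funext => n; rewrite (partial_prod_norm _ _ (phases_invariant g)).
exact: cvg_cst.
Qed.

Lemma inf_prod_bounded g : exists M : K, 0 <= M /\ forall u, `|inf_prod g u| <= M * `|u|.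
Proof. by exists 1; split=> // u; rewrite mul1r inf_prod_norm. Qed.

Definition inf_prod_op g : bounded_op H := @BoundedOp K H (inf_prod g) (inf_prod_bounded g).

Lemma inf_prodK g u : inf_prod (good_opp g) (inf_prod g u) = u.
Proof.
have h := partial_prod_cvg_seq (g := good_opp g) (@inf_prod_cvg g u).
apply: (@cvg_unique H (@norm_hausdorff _ _) _ _ _ _ h).
have -> : (fun n => partial_prod (good_opp g) n (partial_prod g n u)) = fun=> u.
  by apply/funext => n; rewrite (partial_prodK _ _ (phases_invariant g)).
exact: cvg_cst.
Qed.

Lemma good_oppK g : phases (good_opp (good_opp g)) = g.
Proof. by rewrite /= opp_phasesK. Qed.

Lemma inf_prodVK g u : inf_prod g (inf_prod (good_opp g) u) = u.
Proof.
rewrite -{2}(inf_prodK (good_opp g) u); apply: inf_prod_eq.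
by have := @inf_prod_cvg (good_opp (good_opp g)) (inf_prod (good_opp g) u); rewrite good_oppK.
Qed.

Lemma bounded_op_eq (S T : bounded_op H) : (forall u, S u = T u) -> S = T.
Proof.
case: S T => [S hS] [T hT] /= ST.
have e : S = T.
  case: S ST {hS} => S [[S1] [S2]] /= ST; case: T ST {hT} => T [[T1] [T2]] /= ST.
  have {}ST : S = T by apply/funext.
  subst T; congr (GRing.Linear.Pack (GRing.Linear.Class _ _)); congr (_ _);
    exact: Prop_irrelevance.
by subst T; congr BoundedOp; exact: Prop_irrelevance.
Qed.

Lemma inf_prod_adj g u v :
  hdot (inf_prod_op g u) v = hdot u (inf_prod_op (good_opp g) v).
Proof.
have h1 : (fun n => hdot (partial_prod g n u) v) @ \oo --> hdot (inf_prod g u) v.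
  by apply: hdot_cvgl; exact: inf_prod_cvg.
have h2 : (fun n => hdot u (partial_prod (good_opp g) n v)) @ \oo -->
    hdot u (inf_prod (good_opp g) v).
  by apply: hdot_cvgr; exact: inf_prod_cvg.
have h3 : (fun n => hdot (partial_prod g n u) v) =
    (fun n => hdot u (partial_prod (good_opp g) n v)).
  by apply/funext => n; apply: partial_prod_adj; exact: phases_invariant.
rewrite h3 in h1. exact: (@cvg_unique K (@norm_hausdorff _ _) _ _ _ _ h1 h2).
Qed.

Lemma inf_prod_mulVU g :
  bop_comp (inf_prod_op (good_opp g)) (inf_prod_op g) = bop_id.
Proof. by apply: bounded_op_eq => u; exact: inf_prodK. Qed.

Lemma inf_prod_mulUV g :
  bop_comp (inf_prod_op g) (inf_prod_op (good_opp g)) = bop_id.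
Proof. by apply: bounded_op_eq => u; exact: inf_prodVK. Qed.

Definition inf_prod_unitary g : unitary H :=
  Unitary (@inf_prod_adj g) (inf_prod_mulVU g) (inf_prod_mulUV g).

Definition scale_phases (k : R) th l x : R := k * th l x.

Lemma inf_prod_iter g n u :
  (fun L => partial_prod (scale_phases n%:R g) L u) @ \oo -->
  (iter n (bop_comp (inf_prod_op g)) bop_id : bounded_op H) u.
Proof.
elim: n => [|n IH].
  have -> : (fun L => partial_prod (scale_phases 0%:R g) L u) = fun=> u.
    apply/funext => L; rewrite -[RHS](partial_prod0 L); congr partial_prod.
    by apply/funext => l; apply/funext => x; rewrite /scale_phases mul0r.
  exact: cvg_cst.
have -> : (fun L => partial_prod (scale_phases n.+1%:R g) L u) =
   (fun L => partial_prod g L (partial_prod (scale_phases n%:R g) L u)).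
  apply/funext => L; rewrite -partial_prodD; last 2 first.
  - exact: phases_invariant.
  - by move=> l m x; rewrite /scale_phases (phases_invariant g).
  congr partial_prod; apply/funext => l; apply/funext => x.
  by rewrite /= /scale_phases -natr1 mulrDl mul1r addrC.
exact: partial_prod_cvg_seq IH.
Qed.

(** The flips commute and phases add up under composition, hence the partial products
of the multiplied phases are the powers of the partial products. *)
Lemma inf_prod_pow g (k : int) u :
  (fun L => partial_prod (scale_phases k%:~R g) L u) @ \oo -->
  unitary_pow (inf_prod_unitary g) k u.
Proof.
case: k => n; first exact: inf_prod_iter.
have -> : scale_phases (Negz n)%:~R g = scale_phases n.+1%:R (good_opp g).
  apply/funext => l; apply/funext => x.
  by rewrite /scale_phases NegzE rmorphN /= mulNr /opp_phases mulrN.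
exact: (@inf_prod_iter (good_opp g) n.+1).
Qed.

Lemma ell2_coord_cvg (T : Type) (F : set_system T) (FF : Filter F) (u : T -> H) (v : H) x :
  u @ F --> v -> (fun i => u i x) @ F --> v x.
Proof.
move=> /cvgrPdist_lt uv; apply/cvgrPdist_lt => e /uv; apply: filterS => i.
exact: le_lt_trans (ell2_coord_le (v - u i) x).
Qed.

Lemma partial_prodS th n u :
  partial_prod th n.+1 u = flip n (th n) (partial_prod th n u).
Proof. by []. Qed.

Lemma partial_prod_supp th n x y : flip_invariant th ->
  partial_prod th n (edelta c E x) y != 0 ->
  (exists2 s : seq nat, all (fun l => (l < n)%N) s & y = foldr t x s).
Proof.
move=> ti; elim: n y => [|n IH] y.
  rewrite /= ; have [-> _|_ /eqP//] := eqVneq y x.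
  by exists [::].
rewrite partial_prodS flipE.
have [e1|/IH[s hs ys] _] := eqVneq (partial_prod th n (edelta c E x) y) 0; last first.
  by exists s => //; apply: sub_all hs => l /ltnW; rewrite ltnS.
have [e2|/IH[s hs ys] _] := eqVneq (partial_prod th n (edelta c E x) (t n y)) 0.
  by rewrite e1 e2 !mulr0 addr0 => /eqP.
exists (n :: s); rewrite /= ?ltnSn/=; first by apply: sub_all hs => l /ltnW; rewrite ltnS.
by rewrite -ys tK.
Qed.

Lemma flip_invariant_foldr th s x l : flip_invariant th -> th l (foldr t x s) = th l x.
Proof. by move=> ti; elim: s => [//|m s IH] /=; rewrite ti. Qed.

(** The partial products of the vector x stay in the span of the orbit of x, where the
phases are those of x. *)
Lemma partial_prod_near th n x : flip_invariant th ->
  `|partial_prod th n (edelta c E x) - edelta c E x| <= \sum_(l < n) `|phase (th l x) - 1|.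
Proof.
move=> ti; elim: n => [|n IH]; first by rewrite /= subrr normr0 big_ord0.
rewrite big_ord_recr partial_prodS -(subrKA (partial_prod th n (edelta c E x))) addrC.
apply: le_trans (ler_normD _ _) _; apply: lerD => //.
apply: (@le_trans _ _ (`|phase (th n x) - 1| * `|partial_prod th n (edelta c E x)|)).
  apply: flip_near => // y [/(partial_prod_supp ti)|/(partial_prod_supp ti)] [s _].
    by move=> ->; rewrite flip_invariant_foldr.
  by move=> ys; rewrite -(ti n n y) ys flip_invariant_foldr.
by rewrite partial_prod_norm// ler_piMr// edelta_norm.
Qed.

(** By freshness of x the n-th flip carries no mass back to x: only the identity part
of each factor contributes, as for the integral of a product of independent
functions. *)
Lemma partial_prod_coef th n x : flip_invariant th ->
  (forall m s, all (fun l => (l < m)%N) s -> t m x <> foldr t x s) ->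
  partial_prod th n (edelta c E x) x = \prod_(l < n) halfsum (phase (th l x)).
Proof.
move=> ti fresh; elim: n => [|n IH]; first by rewrite /= eqxx big_ord0.
rewrite big_ord_recr partial_prodS flipE IH mulrC.
have [->|/(partial_prod_supp ti)[s hs /(fresh _ _ hs)//]] :=
  eqVneq (partial_prod th n (edelta c E x) (t n x)) 0.
by rewrite mulr0 addr0.
Qed.

Lemma scale_phases_invariant k g : flip_invariant (scale_phases k g).
Proof. by move=> l m x; rewrite /scale_phases (phases_invariant g). Qed.

Lemma unitary_pow_near g (k : int) x (e : K) :
  (forall n, \sum_(l < n) `|phase (k%:~R * g l x) - 1| <= e) ->
  `|unitary_pow (inf_prod_unitary g) k (edelta c E x) - edelta c E x| <= e.
Proof.
move=> he; apply: (complex_cvg_le c (F := \oo) _).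
  apply: cvg_norm; apply: cvgB; first exact: (@inf_prod_pow g k (edelta c E x)).
  exact: cvg_cst.
exists 0%N => // n _ /=; apply: le_trans (he n).
exact: (partial_prod_near n x (@scale_phases_invariant k%:~R g)).
Qed.

Lemma unitary_pow_coef g (k : int) x l0 :
  (forall m s, all (fun l => (l < m)%N) s -> t m x <> foldr t x s) ->
  `|unitary_pow (inf_prod_unitary g) k (edelta c E x) x| <=
    `|halfsum (phase (k%:~R * g l0 x))|.
Proof.
move=> fresh; apply: (complex_cvg_le c (F := \oo) _).
  apply: cvg_norm; apply: ell2_coord_cvg; exact: (@inf_prod_pow g k (edelta c E x)).
exists l0.+1 => // n /= ln.
rewrite (partial_prod_coef n (@scale_phases_invariant k%:~R g) fresh) normr_prod.
rewrite (bigD1 (Ordinal ln))//= ler_piMr// prodr_ile1// => i _.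
by rewrite normr_ge0/= halfsum_le// phase_norm.
Qed.

End Product.

(** * Idempotent ultrafilters *)

Section Idempotents.
Implicit Types (F p q : set_system posnat) (A B : set posnat) (m n : posnat).

Definition shift A n : set posnat := [set y | A (posnat_add y n)].

Lemma posnat_addC m n : posnat_add m n = posnat_add n m.
Proof. by apply: val_inj; rewrite /= addnC. Qed.

Lemma posnat_addA l m n : posnat_add l (posnat_add m n) = posnat_add (posnat_add l m) n.
Proof. by apply: val_inj; rewrite /= addnA. Qed.

Lemma shift_shift A m n : shift (shift A m) n = shift A (posnat_add m n).
Proof.
by apply/seteqP; split=> y; rewrite /shift/= -posnat_addA (posnat_addC n).
Qed.

Lemma shiftI A B n : shift (A `&` B) n = shift A n `&` shift B n.
Proof. by []. Qed.

(** If F is contained in F + F, the ultrafilters above F form a closed subsemigroup;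
larger filters correspond to smaller subsemigroups. *)
Definition subsemigroup F : Prop := ProperFilter F /\ F `<=` uf_add F F.

Definition large_shifts p A : set posnat := [set n | p (shift A n)].

Lemma large_shiftsI p A B : ProperFilter p ->
  large_shifts p (A `&` B) = large_shifts p A `&` large_shifts p B.
Proof.
move=> pp; apply/seteqP; split=> [n|n [pA pB]]; last exact: filterI.
by move=> h; split; apply: filterS h => y [].
Qed.

Lemma large_shiftsS p A B : ProperFilter p -> A `<=` B ->
  large_shifts p A `<=` large_shifts p B.
Proof. by move=> pp AB n; apply: filterS => y; exact: AB. Qed.

Lemma large_shiftsT p : ProperFilter p -> large_shifts p setT = setT.
Proof. by move=> pp; apply/seteqP; split=> // n _; exact: filterT. Qed.

Lemma large_shifts0 p : ProperFilter p -> large_shifts p set0 = set0.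
Proof. by move=> pp; apply/seteqP; split=> // n; exact: filter_not_empty. Qed.

Lemma large_shifts_shift p A n : large_shifts p (shift A n) = shift (large_shifts p A) n.
Proof.
apply/seteqP; split=> y; rewrite /large_shifts/= shift_shift ?[shift _ n]/(shift _ n);
  by rewrite /shift/= (posnat_addC n).
Qed.

Lemma uf_addE p q A : uf_add p q A = q (large_shifts p A). Proof. by []. Qed.

Lemma uf_add_proper p F : ProperFilter p -> ProperFilter F -> ProperFilter (uf_add p F).
Proof.
move=> pp FF; split; first by rewrite uf_addE large_shifts0//; exact: filter_not_empty.
split.
- by rewrite uf_addE large_shiftsT//; exact: filterT.
- by move=> A B; rewrite !uf_addE large_shiftsI// => hA hB; exact: filterI.
- by move=> A B AB; rewrite !uf_addE; apply: filterS; exact: large_shiftsS.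
Qed.

(** A maximal filter of this kind plays the role of a minimal closed subsemigroup. *)
Lemma subsemigroup_maximal F0 : subsemigroup F0 -> exists F,
  [/\ subsemigroup F, F0 `<=` F & forall G, subsemigroup G -> F `<=` G -> G = F].
Proof.
(* The empty family is admitted because it is the union of the empty chain. *)
move=> S0; pose P F := F = set0 \/ (subsemigroup F /\ F0 `<=` F).
have [C CP tot|F [PF maxF]] := @Zorn_bigcup (set posnat) P.
  have [[X CX X0]|nX] := pselect (exists2 X, C X & X <> set0); last first.
    left; apply/seteqP; split=> // A [X CX XA]; apply: nX; exists X => // X0.
    by rewrite X0 in XA.
  right; have [//|[[XX sX] F0X]] := CP X CX.
  have good Y A : C Y -> Y A -> subsemigroup Y.
    by move=> CY YA; have [Y0|[]//] := CP Y CY; rewrite Y0 in YA.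
  split; last by move=> A /F0X XA; exists X.
  split; first split.
  - by move=> [Y CY Y0]; have [/filter_not_empty] := good Y set0 CY Y0.
  - split.
    + by exists X => //; exact: filterT.
    + move=> A B [Y CY YA] [Z CZ ZB].
      have [[FY _] [FZ _]] := (good Y A CY YA, good Z B CZ ZB).
      have [YZ|ZY] := tot _ _ CY CZ.
        by exists Z => //; apply: filterI => //; exact: YZ.
      by exists Y => //; apply: filterI => //; exact: ZY.
    + move=> A B AB [Y CY YA]; have [FY _] := good Y A CY YA.
      by exists Y => //; exact: filterS YA.
  - move=> A [Y CY YA]; have [FY sY] := good Y A CY YA.
    exists Y => //; move: (sY A YA); rewrite uf_addE; apply: filterS => n Yn.
    by exists Y.
have gF : subsemigroup F /\ F0 `<=` F.
  case: PF => // F0'; exfalso; apply: (maxF F0); last by right; split.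
  rewrite F0'; split; first by move=> A.
  by move=> /(_ setT); apply; have [? _] := S0; exact: filterT.
have [sF F0F] := gF; exists F; split=> // G sG FG.
apply: contrapT => GF; apply: (maxF G).
  by split=> // GF'; apply: GF; apply/seteqP; split.
by right; split=> //; exact: subset_trans F0F FG.
Qed.

(** This filter corresponds to the set p + S, a closed subsemigroup of S when p is in
S. *)
Lemma subsemigroup_translate F p : subsemigroup F -> ProperFilter p -> F `<=` p ->
  subsemigroup (uf_add p F) /\ F `<=` uf_add p F.
Proof.
move=> [FF sF] pp Fp.
have FpF : F `<=` uf_add p F by move=> A /sF; rewrite !uf_addE; apply: filterS => n; exact: Fp.
split=> //; split; first exact: uf_add_proper.
move=> A; rewrite !uf_addE => /sF hA.
have -> : large_shifts (uf_add p F) A = [set n | F (shift (large_shifts p A) n)].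
  apply/funext => n.
  change (F (large_shifts p (shift A n)) = F (shift (large_shifts p A) n)).
  by rewrite large_shifts_shift.
by rewrite -uf_addE; exact: FpF.
Qed.

(** The filter of the set of those q in S with p + q = p. *)
Definition fiber F p : set_system posnat :=
  [set B | exists A C, [/\ p A, F C & large_shifts p A `&` C `<=` B]].

(** The equation uf_add p F = F says that p + S = S; in particular p itself is of the
form p + q with q in S, which is why the fiber is not improper. *)
Lemma subsemigroup_fiber F p : subsemigroup F -> UltraFilter p -> F `<=` p ->
  uf_add p F = F -> subsemigroup (fiber F p) /\ F `<=` fiber F p.
Proof.
move=> [FF sF] up Fp pF; have pp := @ultra_proper _ _ up.
split; last by move=> C FC; exists setT, C; split; [exact: filterT|exact: FC|by move=> n []].
split; last first.
  move=> B [A [C [pA FC ACB]]]; exists A, [set n | F (shift C n)]; split=> //.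
    exact: sF.
  move=> n [pAn FCn]; exists (shift A n), (shift C n); split=> //.
  by rewrite large_shifts_shift -shiftI => y; exact: ACB.
split.
  move=> [A [C [pA FC AC0]]].
  have /(filter_not_empty p) : p set0 => //.
  have : p (A `&` ~` A); last by rewrite setICr.
  apply: filterI => //; apply: Fp; rewrite -pF uf_addE; apply: filterS FC => n Cn.
  have [pAn|//] := in_ultra_setVsetC (shift A n) up.
  by case: (AC0 n).
split.
- by exists setT, setT; split; [exact: filterT|exact: filterT|by []].
- move=> B B' [A [C [pA FC h]]] [A' [C' [pA' FC' h']]].
  exists (A `&` A'), (C `&` C'); split; [exact: filterI|exact: filterI|].
  by rewrite large_shiftsI// => n [[a a'] [c' c'']]; split; [exact: h|exact: h'].
- move=> B B' BB' [A [C [pA FC h]]]; exists A, C; split=> //.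
  exact: subset_trans h BB'.
Qed.

(** Ellis' argument: a minimal closed subsemigroup S satisfies p + S = S for each of
its elements p, and then q = p solves p + q = p. *)
Lemma idempotent_ultrafilter F0 : subsemigroup F0 ->
  exists p, [/\ UltraFilter p, F0 `<=` p & uf_add p p = p].
Proof.
move=> /subsemigroup_maximal[F [sF F0F maxF]].
have FF := sF.1; have [p [up Fp]] := ultraFilterLemma FF.
have pp := @ultra_proper _ _ up.
have pF : uf_add p F = F.
  by have [h1 h2] := subsemigroup_translate sF pp Fp; exact: maxF.
have fF : fiber F p = F.
  by have [h1 h2] := subsemigroup_fiber sF up Fp pF; exact: maxF.
have pE : p = F.
  apply/seteqP; split=> // A pA; rewrite -pF uf_addE -fF.
  by exists A, setT; split; [exact: pA|exact: filterT|by move=> n []].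
exists p; split; [exact: up|exact: subset_trans F0F Fp|].
have -> : uf_add p p = uf_add p F by rewrite -pE.
by rewrite pF.
Qed.

End Idempotents.

(** * Rational functionals separating a subgroup *)

Section Separation.
Implicit Types (P Q v : {poly int}) (t : nat -> rat) (G : set {poly int}) (n : nat).

Definition pairing P t n : rat := \sum_(j < n) (P`_j)%:~R * t j.

Lemma pairingB P Q t n : pairing (P - Q) t n = pairing P t n - pairing Q t n.
Proof.
rewrite /pairing -sumrB; apply: eq_bigr => j _.
by rewrite coefB rmorphB/= mulrBl.
Qed.

Lemma pairingZ (k : int) P t n : pairing (k *: P) t n = k%:~R * pairing P t n.
Proof.
rewrite /pairing mulr_sumr; apply: eq_bigr => j _.
by rewrite coefZ rmorphM/= mulrA.
Qed.

Lemma pairingS P t n : pairing P t n.+1 = pairing P t n + (P`_n)%:~R * t n.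
Proof. by rewrite /pairing big_ord_recr. Qed.

Definition subgroup G : Prop := G 0 /\ (forall P Q, G P -> G Q -> G (P - Q)).

Lemma subgroupZ G (k : int) P : subgroup G -> G P -> G (k *: P).
Proof.
move=> [G0 GB] GP.
have GN Q : G Q -> G (- Q) by move=> GQ; rewrite -[- Q]add0r; exact: GB.
have GD Q Q' : G Q -> G Q' -> G (Q + Q').
  by move=> GQ GQ'; rewrite -[Q']opprK; apply: GB => //; exact: GN.
have Gn (m : nat) : G (m%:Z *: P).
  elim: m => [|m IH]; first by rewrite scale0r.
  by rewrite -addn1 PoszD scalerDl scale1r; exact: GD.
by case: k => m; [exact: Gn|rewrite NegzE scaleNr; exact/GN/Gn].
Qed.

(** The coefficients of degree n of the elements of G form an ideal of the integers,
and g realises a generator. *)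
Lemma coef_generator G n : subgroup G ->
  exists2 g, G g & forall P, G P -> (g`_n %| P`_n)%Z.
Proof.
move=> sG; have [G0 GB] := sG.
have [[g1 Gg1 g1n]|none] := pselect (exists2 g, G g & g`_n != 0); last first.
  exists 0 => // P GP; rewrite coef0; apply/dvdzP; exists 0; rewrite mul0r.
  by apply/eqP; apply: contrapT => /negP h; apply: none; exists P.
pose Q m := `[< exists2 g, G g & (0 < m)%N && (absz g`_n == m) >].
have exQ : exists m, Q m.
  exists (absz g1`_n); apply/asboolP; exists g1 => //.
  by rewrite eqxx andbT absz_gt0.
case: (ex_minnP exQ) => m /asboolP[g Gg /andP[m0 /eqP gm]] mmin.
have gn0 : g`_n != 0 by rewrite -absz_gt0 gm.
exists g => // P GP; apply/dvdzP; exists (P`_n %/ g`_n)%Z.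
pose r := P - (P`_n %/ g`_n)%Z *: g.
have Gr : G r by apply: GB => //; exact: subgroupZ.
have rn : r`_n = (P`_n %% g`_n)%Z by rewrite coefB coefZ.
have [r0|r0] := eqVneq (r`_n) 0.
  by rewrite {1}(divz_eq (P`_n) (g`_n)) -rn r0 addr0.
exfalso; have : (m <= absz (r`_n)%R)%N.
  by apply: mmin; apply/asboolP; exists r => //; rewrite eqxx andbT absz_gt0.
rewrite leqNgt => /negP; apply; rewrite -gm.
by rewrite -ltz_nat rn !abszE ger0_norm ?modz_ge0// ltz_mod.
Qed.

Definition is_int (x : rat) : Prop := exists k : int, x = k%:~R.

Lemma is_intD x y : is_int x -> is_int y -> is_int (x + y).
Proof. by move=> [k ->] [l ->]; exists (k + l); rewrite rmorphD. Qed.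

Lemma is_intN x : is_int x -> is_int (- x).
Proof. by move=> [k ->]; exists (- k); rewrite rmorphN. Qed.

Lemma is_intM x y : is_int x -> is_int y -> is_int (x * y).
Proof. by move=> [k ->] [l ->]; exists (k * l); rewrite rmorphM. Qed.

Definition extend t n (x : rat) : nat -> rat := fun j => if j == n then x else t j.

Lemma pairing_extend P t n x : pairing P (extend t n x) n.+1 = pairing P t n + (P`_n)%:~R * x.
Proof.
rewrite pairingS /extend eqxx; congr (_ + _); apply: eq_bigr => j _.
by rewrite ltn_eqF.
Qed.

Lemma pairing0 P n : pairing P (fun=> 0) n = 0.
Proof. by rewrite /pairing big1// => j _; rewrite mulr0. Qed.

Lemma size_drop P n : (size P <= n.+1)%N -> P`_n = 0 -> (size P <= n)%N.
Proof.
move=> sP Pn; apply/leq_sizeP => j; rewrite leq_eqVlt => /orP[/eqP <-//|nj].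
by move/leq_sizeP: sP; apply.
Qed.

(** Induction on the number of coefficients.  If the top coefficient of v is not in the
ideal generated by those of G, it is separated from it by a functional of this
coefficient alone.  Otherwise subtract from v a multiple of the generator g of
[coef_generator], apply the induction hypothesis to the elements of G without top
coefficient, and choose the last value of the functional so that it vanishes on
g. *)
Lemma separation n G v : subgroup G -> (forall P, G P -> (size P <= n)%N) ->
  (size v <= n)%N -> ~ G v ->
  exists t, (forall P, G P -> is_int (pairing P t n)) /\ ~ is_int (pairing v t n).
Proof.
elim: n G v => [|n IH] G v sG Gn vn Gv.
  exfalso; apply: Gv; move: vn; rewrite leqn0 size_poly_eq0 => /eqP ->.
  exact: sG.1.
have [g Gg gdvd] := coef_generator n sG.
have [gv|gv] := boolP (g`_n %| v`_n)%Z; last first.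
  pose x : rat := if g`_n == 0 then (2 * (v`_n)%:~R)^-1 else (g`_n)%:~R^-1.
  exists (extend (fun=> 0) n x); split=> [P /gdvd /dvdzP[q Pq]|].
    rewrite pairing_extend pairing0 add0r Pq /x; have [->|g0] := eqVneq (g`_n) 0.
      by exists 0; rewrite mulr0 mul0r.
    by exists q; rewrite rmorphM/= mulfK ?intr_eq0.
  rewrite pairing_extend pairing0 add0r /x; move: gv; have [->|g0] := eqVneq (g`_n) 0.
    rewrite dvd0z => v0 [k hk].
    have : (2 * k)%:~R = 1 :> rat.
      by rewrite rmorphM/= -hk invfM mulrCA mulVKf ?intr_eq0// divff// intr_eq0.
    by rewrite -[1]/(1%:~R) => /(@intr_inj rat) h2; lia.
  move=> /negP gv [k hk]; apply: gv; apply/dvdzP; exists k; apply/(@intr_inj rat).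
  by rewrite rmorphM/= -hk divfK// intr_eq0.
have /dvdzP[q vq] := gv.
pose w := v - q *: g.
have wn : w`_n = 0 by rewrite coefB coefZ vq subrr.
have sw : (size w <= n)%N.
  apply: size_drop => //; apply: leq_trans (size_polyD _ _) _; rewrite size_polyN.
  by rewrite geq_max vn (leq_trans (size_scale_leq _ _))// Gn.
pose G' : set {poly int} := [set P | G P /\ P`_n = 0].
have sG' : subgroup G'.
  split; first by split; [exact: sG.1|rewrite coef0].
  by move=> P Q [GP Pn] [GQ Qn]; split; [exact: sG.2|rewrite coefB Pn Qn subrr].
have [||t [tG tw]] := IH G' w sG' _ sw.
- by move=> P [GP Pn]; apply: size_drop => //; exact: Gn.
- move=> [Gw _]; apply: Gv; have -> : v = w - (- q) *: g by rewrite scaleNr opprK subrK.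
  by apply: sG.2 => //; exact: subgroupZ.
pose x : rat := if g`_n == 0 then 0 else - pairing g t n / (g`_n)%:~R.
have gx : is_int (pairing g t n + (g`_n)%:~R * x).
  rewrite /x; have [g0|g0] := eqVneq (g`_n) 0.
    by rewrite mulr0 addr0; apply: tG.
  by exists 0; rewrite mulrC divfK ?intr_eq0// subrr.
have red P k : P`_n = k * g`_n -> pairing P (extend t n x) n.+1 =
    pairing (P - k *: g) t n + k%:~R * (pairing g t n + (g`_n)%:~R * x).
  move=> Pk; rewrite pairing_extend pairingB pairingZ Pk rmorphM/=.
  by rewrite mulrDr mulrA addrA subrK.
exists (extend t n x); split=> [P GP|].
  have /dvdzP[k Pk] := gdvd P GP.
  rewrite (red _ _ Pk); apply: is_intD; last by apply: is_intM => //; exists k.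
  apply: tG; split; last by rewrite coefB coefZ Pk subrr.
  by apply: sG.2 => //; exact: subgroupZ.
rewrite (red _ _ vq) => h; apply: tw.
rewrite -[pairing w t n](addrK (q%:~R * (pairing g t n + (g`_n)%:~R * x))).
by apply: is_intD => //; apply/is_intN/is_intM => //; exists q.
Qed.

End Separation.

(** * Lacunary sums and approximate integrality *)

Section NearInt.
Variable R : realType.
Implicit Types (x y e d : R).

Definition near_int x e : Prop := exists k : int, `|x - k%:~R| <= e.

Lemma near_int0 e : 0 <= e -> near_int 0 e.
Proof. by move=> e0; exists 0; rewrite subrr normr0. Qed.

Lemma near_intD x y e d : near_int x e -> near_int y d -> near_int (x + y) (e + d).
Proof.
move=> [k hk] [l hl]; exists (k + l); rewrite rmorphD/= opprD addrACA.
by rewrite (le_trans (ler_normD _ _))// lerD.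
Qed.

Lemma near_intZ (z : int) x e : near_int x e -> near_int (z%:~R * x) (`|z%:~R| * e).
Proof.
by move=> [k hk]; exists (z * k); rewrite rmorphM/= -mulrBr normrM ler_wpM2l.
Qed.

Lemma near_int_le x e d : e <= d -> near_int x e -> near_int x d.
Proof. by move=> ed [k hk]; exists k; exact: le_trans hk ed. Qed.

Lemma near_int_small x e : `|x| <= e -> near_int x e.
Proof. by move=> h; exists 0; rewrite subr0. Qed.

Lemma near_int_int (k : int) : near_int k%:~R 0.
Proof. by exists k; rewrite subrr normr0. Qed.

Lemma near_int_sum (I : Type) (s : seq I) (f : I -> R) (e : I -> R) :
  (forall i, near_int (f i) (e i)) ->
  near_int (\sum_(i <- s) f i) (\sum_(i <- s) e i).
Proof.
move=> h; elim: s => [|i s IH]; first by rewrite !big_nil; exact: near_int0.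
by rewrite !big_cons; exact: near_intD.
Qed.

End NearInt.

Section LacunarySequence.
Variable N : nat.
Hypothesis N0 : (0 < N)%N.

(** The factorial makes almost all terms divisible by any given denominator; the power
of the preceding term makes its angle integral at later terms; the last factor
exceeds the N-th power of any sum of preceding terms, and the power of two then
bounds the errors geometrically. *)
Fixpoint lacunary k : nat :=
  if k is k'.+1 then (k`! * 2 ^ k * lacunary k' ^ N * (2 * lacunary k').+1 ^ N)%N else 1%N.

Arguments lacunary : simpl never.

Lemma lacunaryS k : lacunary k.+1 =
  (k.+1`! * 2 ^ k.+1 * lacunary k ^ N * (2 * lacunary k).+1 ^ N)%N.
Proof. by []. Qed.

Lemma lacunary_gt0 k : (0 < lacunary k)%N.
Proof.
elim: k => [//|k IH]; rewrite lacunaryS.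
by rewrite !muln_gt0 fact_gt0 !expn_gt0 IH.
Qed.

Lemma lacunary_dvd k l : (k <= l)%N -> (lacunary k %| lacunary l)%N.
Proof.
move=> /subnKC <-; elim: (l - k)%N => [|d IH]; first by rewrite addn0.
rewrite addnS (dvdn_trans IH)// lacunaryS.
by apply: dvdn_mulr; apply: dvdn_mull; exact: (dvdn_exp N0 (dvdnn _)).
Qed.

Lemma lacunary_dvdX k l : (k < l)%N -> (l`! * lacunary k ^ N %| lacunary l)%N.
Proof.
case: l => [//|l]; rewrite ltnS => kl; rewrite lacunaryS.
apply: dvdn_mulr; rewrite -mulnA dvdn_mul//; apply: dvdn_mull.
by rewrite dvdn_exp2r ?lacunary_dvd.
Qed.

Lemma fact_dvd_lacunary l : (l`! %| lacunary l)%N.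
Proof.
case: l => [//|l]; rewrite lacunaryS; exact: (dvdn_mulr _ (dvdn_mulr _ (dvdn_mulr _ (dvdnn _)))).
Qed.

Lemma lacunary_double l : (2 * lacunary l <= lacunary l.+1)%N.
Proof.
rewrite lacunaryS (leq_trans (leqnSn _))//.
apply: (@leq_trans ((2 * lacunary l).+1 ^ N)); first by rewrite -{1}[_.+1]expn1 leq_pexp2l.
by rewrite leq_pmull// !muln_gt0 fact_gt0 !expn_gt0 lacunary_gt0.
Qed.

Lemma lacunary_sum l : (\sum_(k < l.+1) lacunary k <= 2 * lacunary l)%N.
Proof.
elim: l => [|l IH]; first by rewrite big_ord_recr big_ord0.
rewrite big_ord_recr/=; have := lacunary_double l; move: IH; set s := (\sum_(_ < _) _)%N.
by lia.
Qed.

Lemma lacunary_growth l : ((\sum_(k < l) lacunary k).+1 ^ N * 2 ^ l <= lacunary l)%N.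
Proof.
case: l => [|l]; first by rewrite big_ord0 exp1n.
rewrite lacunaryS mulnC.
apply: leq_mul; last by rewrite leq_exp2r// ltnS lacunary_sum.
by rewrite -mulnA mulnCA leq_pmulr// muln_gt0 fact_gt0 expn_gt0 lacunary_gt0.
Qed.

Section Estimates.
Variables (R : realType) (t : nat -> rat) (M : nat).
Hypothesis t01 : forall j, 0 <= t j <= 1.
Hypothesis M0 : (0 < M)%N.
Hypothesis Mt : forall j, (j <= N)%N -> is_int (M%:R * t j).

Local Notation tR j := (ratr (t j) : R).

(** The product with the j-th power of the l-th term is t_j, up to integers coming from
the summands with i < j and to small errors coming from those with i > j. *)
Definition angle l : R := \sum_(i < N) tR i.+1 / (lacunary l)%:R ^+ i.+1.

Lemma tR01 j : 0 <= tR j <= 1.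
Proof.
by have := t01 j; rewrite -(ler_rat R 0) -(ler_rat R _ 1) rmorph0 rmorph1.
Qed.

Lemma MtR j (m : nat) : (j <= N)%N -> (M %| m)%N -> exists k : int, m%:R * tR j = k%:~R.
Proof.
move=> /Mt[k hk] /dvdnP[q ->]; exists (q%:Z * k).
rewrite natrM -mulrA rmorphM/=; congr (_ * _).
have := congr1 (fun x : rat => ratr x : R) hk.
by rewrite /= rmorphM/= rmorph_nat rmorph_int.
Qed.

Lemma lacunaryR_gt0 l : 0 < (lacunary l)%:R :> R.
Proof. by rewrite ltr0n lacunary_gt0. Qed.

Lemma angle_int l (m : nat) : (M * lacunary l ^ N %| m)%N -> near_int (m%:R * angle l) 0.
Proof.
move=> /dvdnP[q ->]; rewrite /angle mulr_sumr.
apply: (@near_int_le _ _ (\sum_(i < N) 0)); first by rewrite big1.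
apply: near_int_sum => i.
have [k hk] := @MtR i.+1 _ (ltn_ord i) (dvdnn M).
have X0 : (lacunary l)%:R != 0 :> R by rewrite gt_eqF// lacunaryR_gt0.
have -> : (q * (M * lacunary l ^ N))%:R * (tR i.+1 / (lacunary l)%:R ^+ i.+1) =
    (q%:Z * (lacunary l)%:Z ^+ (N - i.+1) * k)%:~R.
  rewrite !natrM natrX -{1}(subnK (ltn_ord i)) exprD !rmorphM/= rmorphXn/= -hk.
  rewrite -[q%:~R]/(q%:R) -[(lacunary l)%:~R]/((lacunary l)%:R).
  by field; rewrite expf_neq0.
exact: near_int_int.
Qed.

(** Expand the power of m + n_l.  A monomial of degree less than i in n_l is small
after division by n_l^i.  The others are multiples of n_l^i, and their quotients
are divisible by M, through m or through n_l, unless i = j and m does not occur. *)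
Lemma angle_term l m j i : (i.+1 <= N)%N -> (M %| m)%N -> (M %| lacunary l)%N ->
  near_int ((m + lacunary l)%:R ^+ j * (tR i.+1 / (lacunary l)%:R ^+ i.+1)
      - (i.+1 == j)%:R * tR i.+1)
    (m.+1%:R ^+ j / (lacunary l)%:R).
Proof.
move=> iN Mm Ml; set x := (lacunary l)%:R : R; set b : R := tR i.+1.
have x0 : 0 < x by exact: lacunaryR_gt0.
have x1 : 1 <= x by rewrite ler1n lacunary_gt0.
have /andP[b0 b1] := tR01 i.+1; rewrite -/b in b0 b1.
pose f (a : 'I_j.+1) : R := m%:R ^+ (j - a) * x ^+ a *+ 'C(j, a) * (b / x ^+ i.+1).
pose g (a : 'I_j.+1) : R := (((a : nat) == i.+1) && (i.+1 == j))%:R * b.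
pose e (a : 'I_j.+1) : R := (m%:R ^+ (j - a) * 1 ^+ a *+ 'C(j, a)) / x.
have -> : (m + lacunary l)%:R ^+ j * (b / x ^+ i.+1) - (i.+1 == j)%:R * b =
    \sum_(a < j.+1) (f a - g a).
  rewrite sumrB natrD exprDn mulr_suml; congr (_ - _).
  have [ij|ij] := eqVneq i.+1 j; last first.
    by rewrite mul0r big1// => a _; rewrite /g (negbTE ij) andbF mul0r.
  rewrite (bigD1 ord_max)//= big1 ?addr0 => [|a /eqP aj]; rewrite /g.
    by rewrite /= ij eqxx.
  rewrite ij (_ : (a : nat) == j = false) ?mul0r//.
  by apply/negbTE/eqP => h; apply: aj; apply: val_inj.
have -> : m.+1%:R ^+ j / x = \sum_(a < j.+1) e a.
  by rewrite -mulr_suml -addn1 natrD exprDn.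
apply: near_int_sum => a.
pose w : R := m%:R ^+ (j - a) *+ 'C(j, a).
have w0 : 0 <= w by rewrite mulrn_wge0// exprn_ge0.
have fE : f a = w * (x ^+ a * (b / x ^+ i.+1)).
  by rewrite /f /w !mulrnAl !mulrA.
have eE : e a = w * x^-1 by rewrite /e expr1n mulr1.
have xn0 n : 0 < x ^+ n by rewrite exprn_gt0.
have [ai|ia] := ltnP a i.+1.
  apply: near_int_small; rewrite /g (ltn_eqF ai) mul0r subr0 fE eE.
  rewrite normrM (ger0_norm w0) ler_wpM2l// ger0_norm; last first.
    by apply: mulr_ge0; [exact/ltW/xn0|apply: divr_ge0; [exact: b0|exact/ltW/xn0]].
  rewrite mulrA ler_pdivrMr// exprS mulKf ?gt_eqF//.
  by rewrite -[leRHS]mulr1 ler_pM// ?ler_weXn2l// ltW.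
apply: (@near_int_le _ _ 0).
  by rewrite eE mulr_ge0 ?invr_ge0 ?(ltW x0).
pose W := (m ^ (j - a) * 'C(j, a) * lacunary l ^ (a - i.+1))%N.
have fW : f a = W%:R * b.
  have xa : x ^+ a = x ^+ (a - i.+1) * x ^+ i.+1 by rewrite -exprD subnK.
  rewrite fE xa /W !natrM !natrX -/x mulr_natr -[RHS]mulrA; congr (_ * _).
  by rewrite -mulrA; congr (_ * _); rewrite mulrCA divff ?mulr1// gt_eqF.
have [/andP[/eqP ai /eqP ij]|ne] := boolP (((a : nat) == i.+1) && (i.+1 == j)).
  rewrite fW /g /W ai ij eqxx/= mul1r !subnn !expn0 binn !mul1n.
  by rewrite mul1r subrr; exact: near_int0.
have MW : (M %| W)%N.
  rewrite /W; have [aj|ja] := ltnP a j.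
    by rewrite -mulnA dvdn_mulr// dvdn_exp// subn_gt0.
  have aj : (a : nat) = j by apply/eqP; rewrite eqn_leq ja andbT -ltnS.
  rewrite dvdn_mull// dvdn_exp// subn_gt0 ltn_neqAle ia andbT.
  by apply: contra ne => /eqP ->; rewrite eqxx aj eqxx.
have [k hk] := MtR iN MW.
by rewrite /g (negbTE ne) mul0r subr0 fW hk; exact: near_int_int.
Qed.

Lemma angle_le l : `|angle l| <= N%:R / (lacunary l)%:R.
Proof.
rewrite (le_trans (ler_norm_sum _ _ _))//.
apply: (@le_trans _ _ (\sum_(i < N) (lacunary l)%:R^-1)); last first.
  by rewrite sumr_const card_ord mulr_natl lexx.
apply: ler_sum => i _.
have /andP[b0 b1] := tR01 i.+1; have x0 := lacunaryR_gt0 l.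
set b : R := tR i.+1 in b0 b1 *.
rewrite ger0_norm; last by apply: mulr_ge0 => //; rewrite invr_ge0 exprn_ge0// ltW.
rewrite ler_pdivrMr ?exprn_gt0// exprS mulKf ?gt_eqF//.
by apply: le_trans b1 _; rewrite exprn_ege1// ler1n lacunary_gt0.
Qed.

Lemma sum_succ_bound l m j : (j <= N)%N -> (m <= \sum_(k < l) lacunary k)%N ->
  m.+1%:R ^+ j / (lacunary l)%:R <= 2^-1 ^+ l :> R.
Proof.
move=> jN mle; rewrite ler_pdivrMr ?lacunaryR_gt0// exprVn mulrC ler_pdivlMr ?exprn_gt0//.
rewrite -!natrX -natrM ler_nat; apply: leq_trans (lacunary_growth l).
rewrite leq_mul2r; apply/orP; right.
by apply: (@leq_trans (m.+1 ^ N)); [rewrite leq_pexp2l|rewrite leq_exp2r].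
Qed.

(** The three parts are the sums of the terms before, at and after the position l: the
part q is invisible, m alone is too small to matter, and b tells whether the l-th
term is present. *)
Lemma angle_monomial l m (b : bool) (q : nat) j :
  (0 < j <= N)%N -> (M %| m)%N -> (b -> M %| lacunary l)%N ->
  (m <= \sum_(k < l) lacunary k)%N -> (M * lacunary l ^ N %| q)%N ->
  near_int ((m + b * lacunary l + q)%:R ^+ j * angle l - b%:R * tR j) (N%:R * 2^-1 ^+ l).
Proof.
move=> /andP[j0 jN] Mm Ml mle qdvd.
set y := (m + b * lacunary l)%N.
have [s hs] : exists s : nat, ((y + q) ^ j = y ^ j + q * s)%N.
  elim: (j) => [|j' [s hs]]; first by exists 0%N; rewrite !expn0 muln0.
  exists (y ^ j' + (y + q) * s)%N; rewrite expnS hs [in RHS]expnS.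
  by ring.
rewrite -natrX hs natrD natrM mulrDl addrAC -[X in near_int _ X]addr0.
apply: near_intD; last first.
  rewrite mulrAC -mulrC; have := near_intZ (Posz s) (angle_int qdvd).
  by rewrite mulr0; apply.
rewrite natrX; case: b @y Ml hs => y Ml hs; last first.
  rewrite mul0r subr0 /y mul0n addn0; apply: near_int_small.
  have x0 := lacunaryR_gt0 l.
  rewrite normrM normrX normr_nat (le_trans (ler_wpM2l _ (angle_le l))) ?exprn_ge0//.
  rewrite mulrCA ler_wpM2l//; apply: le_trans (sum_succ_bound jN mle).
  by apply: ler_wpM2r; rewrite ?invr_ge0 ?(ltW x0)// ler_pXn2r ?nnegrE ?ler0n// ler_nat.
have -> : tR j = \sum_(i < N) (i.+1 == j)%:R * tR i.+1.
  rewrite -(prednK j0) in jN *.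
  rewrite (bigD1 (Ordinal jN))//= eqxx mul1r big1 ?addr0// => i /eqP ij.
  rewrite eqSS (_ : (i : nat) == j.-1 = false) ?mul0r//.
  by apply/negbTE/eqP => h; apply: ij; apply: val_inj.
rewrite mul1r /angle mulr_sumr -sumrB.
apply: (@near_int_le _ _ (\sum_(i < N) m.+1%:R ^+ j / (lacunary l)%:R)).
  by rewrite sumr_const card_ord mulr_natl lerMn2r; apply/orP; right; exact: sum_succ_bound.
by apply: near_int_sum => i; rewrite /y mul1n; apply: angle_term => //; exact: Ml.
Qed.

End Estimates.
End LacunarySequence.

(** * The filter of finite sums *)

Lemma sumn_cat (m n p : nat) (F : pred nat) (f : nat -> nat) : (m <= n)%N -> (n <= p)%N ->
  (\sum_(m <= i < p | F i) f i =
   \sum_(m <= i < n | F i) f i + \sum_(n <= i < p | F i) f i)%N.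
Proof. exact: big_cat_nat. Qed.

Lemma sumn_empty (m n : nat) (F : pred nat) (f : nat -> nat) :
  (forall k, (m <= k < n)%N -> F k = false) -> (\sum_(m <= i < n | F i) f i = 0)%N.
Proof. by move=> h; rewrite big_nat_cond big1// => k /andP[/h ->]. Qed.

Section Blocks.
Variable N : nat.
Hypothesis N0 : (0 < N)%N.
Local Notation lacunary := (lacunary N).

Definition block_sum L D (F : pred nat) (n : nat) : Prop :=
  (forall k, F k -> (L <= k < D)%N) /\ n = \sum_(0 <= k < D | F k) lacunary k.

Definition block L : set posnat :=
  [set n | exists D F, block_sum L D F (sval n)].

Definition block_filter : set_system posnat := filter_from [set: nat] block.

Lemma block_mono L L' : (L <= L')%N -> block L' `<=` block L.
Proof.
move=> LL' n [D [F [hF nE]]]; exists D, F; split=> // k /hF/andP[Lk ->].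
by rewrite (leq_trans LL').
Qed.

Lemma block_sum_widen L D D' F n : (D <= D')%N -> block_sum L D F n -> block_sum L D' F n.
Proof.
move=> DD' [hF ->]; split=> [k /hF/andP[-> /leq_trans]|]; first exact.
rewrite [RHS](sumn_cat _ _ (leq0n D) DD') [X in (_ + X)%N]sumn_empty ?addn0// => k /andP[Dk _].
by apply/negP => /hF/andP[_]; rewrite ltnNge Dk.
Qed.

(** The second summand is taken beyond all the indices used by the first, hence the
indices do not collide. *)
Lemma block_add L D F (n y : posnat) : block_sum L D F (sval n) -> block D y ->
  block L (posnat_add y n).
Proof.
move=> [hF nE] [D' [F' [hF' yE]]].
have LD : (L <= D)%N.
  rewrite leqNgt; apply/negP => DL; have := svalP n; rewrite nE big_nat_cond big1// => k.
  by move=> /andP[/andP[_ kD] /hF/andP[Lk _]]; move: (leq_ltn_trans Lk kD); rewrite ltnNge ltnW.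
have DD' : (D <= D')%N.
  rewrite leqNgt; apply/negP => DL; have := svalP y; rewrite yE big_nat_cond big1// => k.
  by move=> /andP[/andP[_ kD] /hF'/andP[Lk _]]; move: (leq_ltn_trans Lk kD); rewrite ltnNge ltnW.
exists D', (fun k => if (k < D)%N then F k else F' k); split=> [k|].
  case: ifPn => [_ /hF/andP[-> kD]|_ /hF'/andP[Dk ->]]; first exact: leq_trans DD'.
  by rewrite (leq_trans LD).
rewrite /= nE yE addnC [RHS](sumn_cat _ _ (leq0n D) DD'); congr (_ + _)%N.
  by rewrite [LHS]big_nat_cond [RHS]big_nat_cond; apply: eq_bigl => k; case: (k < D)%N.
rewrite (sumn_cat _ _ (leq0n D) DD') sumn_empty ?add0n.
  rewrite [LHS]big_nat_cond [RHS]big_nat_cond; apply: eq_bigl => k.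
  by case: (leqP D k).
move=> k /andP[_ kD]; apply/negP => /hF'/andP[Dk _]; by move: kD; rewrite ltnNge Dk.
Qed.

Lemma block_nonempty L : block L !=set0.
Proof.
exists (exist _ (lacunary L) (lacunary_gt0 N L)), L.+1, (pred1 L).
split=> [k /= /eqP ->|]; first by rewrite leqnn ltnSn.
rewrite /= (sumn_cat _ _ (leq0n L) (leqnSn L)) sumn_empty; last first.
  by move=> k /andP[_ kL] /=; rewrite ltn_eqF.
by rewrite big_mkcond big_nat1 /= eqxx.
Qed.

Lemma block_filter_subsemigroup : subsemigroup block_filter.
Proof.
split.
  apply: filter_from_proper; last by move=> L _; exact: block_nonempty.
  apply: filter_from_filter; first by exists 0%N.
  move=> L L' _ _; exists (maxn L L') => // n hn.
  by split; apply: block_mono hn; [exact: leq_maxl|exact: leq_maxr].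
move=> A [L _ LA]; exists L => // n [D [F nDF]] /=.
by exists D => // y yD; apply: LA; exact: block_add nDF yD.
Qed.

Section Estimates.
Variables (R : realType) (t : nat -> rat) (M : nat).
Hypothesis t01 : forall j, 0 <= t j <= 1.
Hypothesis M0 : (0 < M)%N.
Hypothesis Mt : forall j, (j <= N)%N -> is_int (M%:R * t j).
Variable P : {poly int}.
Hypothesis sP : (size P <= N.+1)%N.
Hypothesis P0 : P.[0] = 0.

Local Notation angle := (angle N R t).

Definition poly_bound : R := N%:R * \sum_(j < N.+1) `|(P`_j)%:~R|.

Lemma poly_bound_ge0 : 0 <= poly_bound.
Proof. by rewrite mulr_ge0// sumr_ge0. Qed.

Lemma poly_nat (n : nat) : (P.[n%:Z])%:~R = \sum_(j < N.+1) (P`_j)%:~R * n%:R ^+ j :> R.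
Proof.
rewrite (horner_coef_wide _ sP) rmorph_sum; apply: eq_bigr => j _.
by rewrite rmorphM rmorphXn.
Qed.

Lemma coefP0 : P`_0 = 0.
Proof. by rewrite -horner_coef0. Qed.

Lemma block_dvd L D F n l k : block_sum L D F n -> (M <= L)%N -> F k -> (l < k)%N ->
  (M * lacunary l ^ N %| lacunary k)%N.
Proof.
move=> [hF _] ML /hF/andP[Lk _] lk; apply: dvdn_trans (lacunary_dvdX N0 lk).
by rewrite dvdn_mul// dvdn_fact// M0 (leq_trans ML).
Qed.

(** Below the block all the terms of n are multiples of M times the N-th power of the
l-th term. *)
Lemma block_estimate_low L D F n l : block_sum L D F n -> (M <= L)%N -> (l < L)%N ->
  near_int ((P.[n%:Z])%:~R * angle l) 0.
Proof.
move=> hn ML lL; have [hF nE] := hn.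
have dn : (M * lacunary l ^ N %| n)%N.
  rewrite nE; apply: dvdn_sum => k Fk; apply: (block_dvd hn ML Fk).
  by have /andP[Lk _] := hF _ Fk; exact: leq_trans lL Lk.
rewrite poly_nat mulr_suml.
apply: (@near_int_le _ _ (\sum_(j < N.+1) 0)); first by rewrite big1.
apply: near_int_sum => -[[|j] hj] /=.
  by rewrite coefP0 !mul0r; exact: near_int0.
have -> : (P`_j.+1)%:~R * n%:R ^+ j.+1 * angle l =
    (P`_j.+1 * n%:Z ^+ j)%:~R * (n%:R * angle l) :> R.
  by rewrite rmorphM rmorphXn/= exprSr !mulrA.
have := near_intZ (P`_j.+1 * n%:Z ^+ j) (angle_int R Mt dn).
by rewrite mulr0; apply.
Qed.

Lemma block_estimate L D F n l : block_sum L D F n -> (M <= L)%N ->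
  near_int ((P.[n%:Z])%:~R * angle l - (F l)%:R * ratr (pairing P t N.+1))
    (poly_bound * 2^-1 ^+ l).
Proof.
move=> hn0 ML.
have hn := block_sum_widen (leq_maxl D l.+1) hn0.
have [hF nE] := hn; set D' := maxn D l.+1 in hF nE hn.
have lD : (l < D')%N by exact: leq_maxr.
pose m := (\sum_(0 <= k < l | F k) lacunary k)%N.
pose q := (\sum_(l.+1 <= k < D' | F k) lacunary k)%N.
have nmq : n = (m + F l * lacunary l + q)%N.
  rewrite nE (sumn_cat _ _ (leq0n l.+1) lD) (sumn_cat _ _ (leq0n l) (leqnSn l)).
  by rewrite [X in (_ + X + _)%N]big_mkcond big_nat1; case: (F l); rewrite ?mul1n ?mul0n.
have Mk k : F k -> (M %| lacunary k)%N.
  move=> /hF/andP[Lk _]; apply: dvdn_trans (fact_dvd_lacunary N k).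
  by rewrite dvdn_fact// M0 (leq_trans ML).
have Mm : (M %| m)%N by apply: dvdn_sum => k; exact: Mk.
have Mq : (M * lacunary l ^ N %| q)%N.
  rewrite /q big_nat_cond; apply: dvdn_sum => k /andP[/andP[lk _] Fk].
  exact: (block_dvd hn ML Fk lk).
have mle : (m <= \sum_(k < l) lacunary k)%N.
  rewrite /m big_mkord big_mkcond/=; apply: leq_sum => k _; by case: (F k).
have -> : (P.[n%:Z])%:~R * angle l - (F l)%:R * ratr (pairing P t N.+1) =
   \sum_(j < N.+1) (P`_j)%:~R * (n%:R ^+ j * angle l - (F l)%:R * ratr (t j)) :> R.
  rewrite poly_nat mulr_suml /pairing rmorph_sum mulr_sumr -sumrB/=.
  apply: eq_bigr => j _; rewrite rmorphM/= ratr_int mulrBr; congr (_ - _); ring.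
have -> : poly_bound * 2^-1 ^+ l =
   \sum_(j < N.+1) `|(P`_j)%:~R| * (N%:R * 2^-1 ^+ l) :> R.
  by rewrite -mulr_suml /poly_bound; ring.
apply: near_int_sum => j; have [j0|j0] := posnP j.
  by rewrite j0 coefP0 !mul0r normr0 mul0r; exact: near_int0.
apply: near_intZ; rewrite nmq; apply: (@angle_monomial N N0 R t M t01 Mt l m (F l) q j) => //.
  by rewrite j0 -ltnS/=.
exact: Mk.
Qed.

End Estimates.

End Blocks.

(** * Estimates of phases and of their means *)

Section PhaseEstimates.
Variables (R : realType) (K : numClosedFieldType) (c : real_form R K).

Lemma phase_near_int (x e : R) : near_int x e -> `|phase c x - 1| <= c (pi *+ 4 * e).
Proof.
move=> [k hk]; rewrite -[x](subrK k%:~R) phaseD_int.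
apply: le_trans (phase_lipschitz c _) _; rewrite ofreal_le ler_wpM2l// mulrn_wge0//.
exact: pi_ge0.
Qed.

Lemma geometric_sum_le (D : K) L n (f : nat -> K) : 0 <= D ->
  (forall l, (l < L)%N -> f l = 0) -> (forall l, f l <= D * 2^-1 ^+ l) ->
  \sum_(l < n) f l <= 2 * D * 2^-1 ^+ L.
Proof.
move=> D0 f0 fD.
have [nL|/ltnW Ln] := leqP n L.
  rewrite big1 ?mulr_ge0 ?exprn_ge0 ?invr_ge0// => l _; apply: f0.
  exact: leq_trans (ltn_ord l) nL.
apply: (@le_trans _ _ (2 * D * (2^-1 ^+ L - 2^-1 ^+ n))); last first.
  by rewrite ler_wpM2l ?mulr_ge0// gerBl exprn_ge0 ?invr_ge0.
rewrite -(subnKC Ln); elim: (n - L)%N => [|d IH].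
  rewrite addn0 subrr mulr0 big1// => l _; exact: f0.
rewrite addnS big_ord_recr/=; apply: le_trans (lerD IH (fD _)) _.
by rewrite exprS le_eqVlt; apply/orP; left; apply/eqP; field.
Qed.

(** Parallelogram identity for 1 and z. *)
Lemma halfsum_lt1 (z : K) : `|z| = 1 -> z != 1 -> `|halfsum z| < 1.
Proof.
move=> z1 zn1; rewrite normrM normfV (ger0_norm (ler0n K 2)) ltr_pdivrMr// mul1r.
rewrite -(ltr_pXn2r (n := 2)) ?nnegrE//.
have : `|1 + z| ^+ 2 + `|1 - z| ^+ 2 = 4.
  rewrite !normCK !(rmorphD, rmorphB) rmorph1 /=.
  have zz : z * z^* = 1 by rewrite -normCK z1 expr1n.
  transitivity (2 + 2 * (z * z^*)); first by ring.
  by rewrite zz; ring.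
have d0 : 0 < `|1 - z| ^+ 2 by rewrite exprn_gt0// normr_gt0 subr_eq0 eq_sym.
move=> h; rewrite -(ltrD2r (`|1 - z| ^+ 2)) h -natrX.
by rewrite ltrDl.
Qed.

Lemma halfsum_near (z w : K) : `|z| = 1 -> `|halfsum (z * w)| <= `|halfsum z| + `|w - 1|.
Proof.
move=> z1; have -> : halfsum (z * w) = halfsum z + z * (w - 1) / 2.
  by rewrite /halfsum; field.
rewrite (le_trans (ler_normD _ _))// lerD2l !normrM z1 mul1r normfV.
by rewrite (ger0_norm (ler0n K 2)) ler_pdivrMr// ler_peMr// ler1n.
Qed.

End PhaseEstimates.

(** * The Walsh basis *)

Section SetFlips.

Definition toggle l (S : {fset nat}) : {fset nat} :=
  if l \in S then (S `\ l)%fset else (l |` S)%fset.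

Lemma in_toggle l S k : (k \in toggle l S) = (k == l) (+) (k \in S).
Proof.
rewrite /toggle; case: ifPn => lS; rewrite !inE; have [->|kl] //= := eqVneq k l.
  by rewrite lS.
Qed.

Lemma toggleK l : involutive (toggle l).
Proof. by move=> S; apply/fsetP => k; rewrite !in_toggle addbA addbb. Qed.

Lemma toggleC l m S : toggle l (toggle m S) = toggle m (toggle l S).
Proof. by apply/fsetP => k; rewrite !in_toggle addbCA. Qed.

(** A pair of the code of a functional and of a finite set of coins. *)
Definition walsh_index : choiceType := (nat * {fset nat})%type.

Definition walsh_flip l (x : walsh_index) : walsh_index := (x.1, toggle l x.2).

Lemma walsh_flipK l : involutive (walsh_flip l).
Proof. by move=> [i S]; rewrite /walsh_flip/= toggleK. Qed.

Lemma walsh_flipC l m x : walsh_flip l (walsh_flip m x) = walsh_flip m (walsh_flip l x).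
Proof. by rewrite /walsh_flip/= toggleC. Qed.

Definition segment n : {fset nat} := [fset k in iota 0 n]%fset.

Lemma in_segment n k : (k \in segment n) = (k < n)%N.
Proof. by rewrite !inE mem_iota. Qed.

Definition walsh_box n : {fset walsh_index} := (segment n `*` fpowerset (segment n))%fset.

Lemma in_walsh_box n x :
  (x \in walsh_box n) = (x.1 < n)%N && (x.2 `<=` segment n)%fset.
Proof. by rewrite in_fsetM in_segment fpowersetE. Qed.

Lemma walsh_box_mono m n : (m <= n)%N -> (walsh_box m `<=` walsh_box n)%fset.
Proof.
move=> mn; apply/fsubsetP => x; rewrite !in_walsh_box => /andP[xm sm].
rewrite (leq_trans xm mn)/=; apply: fsubset_trans sm _; apply/fsubsetP => k.
by rewrite !in_segment => /leq_trans; apply.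
Qed.

Lemma walsh_box_cover x : exists n, x \in walsh_box n.
Proof.
exists (maxn x.1.+1 (\max_(k <- x.2) k).+1); rewrite in_walsh_box leq_maxl/=.
apply/fsubsetP => k kS; rewrite in_segment; apply: leq_trans (leq_maxr _ _).
by rewrite ltnS; apply: (@leq_bigmax_seq _ _ xpredT id).
Qed.

Definition walsh_exhaustion : exhaustion walsh_index :=
  Exhaustion walsh_box_mono walsh_box_cover.

Lemma walsh_flip_box l n x : (l < n)%N -> x \in walsh_exhaustion n ->
  walsh_flip l x \in walsh_exhaustion n.
Proof.
move=> ln; rewrite !in_walsh_box/= => /andP[-> /fsubsetP sn] /=.
apply/fsubsetP => k; rewrite in_toggle; have [->|_] := eqVneq k l.
  by rewrite in_segment.
exact: sn.
Qed.

(** Toggling coins below m never changes the state of the coin m. *)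
Lemma walsh_flip_fresh i m s : all (fun l => (l < m)%N) s ->
  walsh_flip m (i, fset0) <> foldr walsh_flip (i, fset0) s.
Proof.
move=> hs e; have : m \in (walsh_flip m (i, fset0)).2 by rewrite in_toggle eqxx inE.
rewrite e => {e}; elim: s hs => [_|l s IH /andP[lm /IH]] /=; first by rewrite inE.
by rewrite in_toggle (gtn_eqF lm).
Qed.

End SetFlips.

(** * Weak and strong convergence *)

Section StrongConvergence.
Variables (K : numClosedFieldType) (H : hilbertType K).

Lemma unitary_norm (U : unitary H) u : `|U u| = `|u|.
Proof.
apply/eqP; rewrite -(eqrXn2 (n := 2))// -!hdotE unitary_adjP; apply/eqP.
by have /(congr1 (fun T : bounded_op H => T u)) /= -> := unitary_mulVU U.
Qed.

Lemma unitary_adj_norm (U : unitary H) u : `|unitary_adj U u| = `|u|.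
Proof.
apply/eqP; rewrite -(eqrXn2 (n := 2))// -!hdotE -unitary_adjP; apply/eqP.
by have /(congr1 (fun T : bounded_op H => T u)) /= -> := unitary_mulUV U.
Qed.

Lemma unitary_pow_norm (U : unitary H) k u : `|unitary_pow U k u| = `|u|.
Proof.
case: k; elim=> [//|n IH].
- exact: etrans (unitary_norm U _) IH.
- exact: unitary_adj_norm.
- exact: etrans (unitary_adj_norm U _) IH.
Qed.

Lemma wot_cvgP (T : Type) (F : set_system T) (A : T -> bounded_op H) (B : bounded_op H) :
  Filter F -> (A : T -> wot H) @ F --> (B : wot H) <->
  forall u v, (fun n => hdot (A n u) v) @ F --> hdot (B u) v.
Proof.
move=> FF; split.
  move=> /cvg_sup h u v; have h1 := h (u, v).
  have ic := @initial_continuous _ _ (@matrix_coef K H (u, v)) B.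
  by move=> W hW; exact: (h1 _ (ic W hW)).
move=> h; apply/cvg_sup => -[u v] W /= [V [[V' oV' <-] BV'] VW].
rewrite nbhs_filterE; apply: (filterS VW); apply: (h u v).
exact: open_nbhs_nbhs.
Qed.

End StrongConvergence.

Section Density.
Variables (R : realType) (K : numClosedFieldType) (c : real_form R K).
Variables (X : choiceType) (E : exhaustion X).
Local Notation H := (ell2_hilbert c E).

(** The vectors fixed in the limit form a closed subspace, because the operators are
equicontinuous, and it contains the basis. *)
Lemma strong_cvg_delta (T : Type) (F : set_system T) (FF : Filter F)
    (A : T -> bounded_op H) :
  (forall n u, `|A n u| = `|u|) ->
  (forall x, (fun n => A n (edelta c E x)) @ F --> edelta c E x) ->
  forall u : H, (fun n => A n u) @ F --> u.
Proof.
move=> An Ad u; apply/cvgrPdist_lt => e e0.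
have e3 : 0 < e / 3 by rewrite divr_gt0.
have [m hm] := box_trunc_approx u e3.
have : (fun n => A n (box_trunc m u)) @ F --> (box_trunc m u : H).
  rewrite /box_trunc; elim: (enum_fset (E m)) => [|x s IH].
    rewrite big_nil (_ : (fun _ => _) = fun=> 0); first exact: cvg_cst.
    by apply/funext => n; rewrite linear0.
  rewrite big_cons (_ : (fun _ => _) = fun n => u x *: A n (edelta c E x) +
      A n (\sum_(y <- s) u y *: edelta c E y)).
    by apply: cvgD IH; apply: cvgZr; exact: Ad.
  by apply/funext => n; rewrite linearD linearZ.
move=> /cvgrPdist_lt/(_ _ e3); apply: filterS => n hn.
have -> : u - A n u = (u - box_trunc m u) + (box_trunc m u - A n (box_trunc m u))
    - A n (u - box_trunc m u).
  by rewrite linearB opprB !subrKA.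
rewrite (le_lt_trans (ler_normB _ _))// An.
have -> : e = e / 3 + e / 3 + e / 3 by field.
by rewrite ltrD// (le_lt_trans (ler_normD _ _))// ltrD.
Qed.

Lemma edot_delta (u : ell2 c E) x : edot u (edelta c E x) = u x.
Proof.
apply: totsum_eq; have [m xm] := box_cover E x.
apply: (@cvg_trans _ ((fun=> u x) @ \oo)); last exact: cvg_cst.
apply: near_eq_cvg; exists m => // n /= mn; have /fsubsetP sub := box_mono E mn.
rewrite /boxsum (big_fsetD1 x) ?sub//= eqxx rmorph1 mulr1 big_seq big1 ?addr0// => y.
by rewrite !inE => /andP[/negbTE -> _]; rewrite rmorph0 mulr0.
Qed.

End Density.

(** * The rigid unitary operator *)

Section Characters.
Variable N : nat.

Definition character_of (i : nat) : nat -> rat :=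
  if @choice.unpickle (seq rat) i is Some s then nth 0 s else fun=> 0.

Definition admissible (G : set {poly int}) (t : nat -> rat) : Prop :=
  (forall j, 0 <= t j <= 1) /\ (forall P, G P -> is_int (pairing P t N.+1)).

Lemma common_denominator (t : nat -> rat) :
  exists2 M : nat, (0 < M)%N & forall j, (j <= N)%N -> is_int (M%:R * t j).
Proof.
elim: N => [|n [M M0 hM]].
  exists (absz (denq (t 0%N))); first by rewrite absz_gt0 denq_neq0.
  move=> j; rewrite leqn0 => /eqP ->; exists (numq (t 0%N)).
  by rewrite natr_absz gtr0_norm ?denq_gt0// mulrC numqE.
pose d := absz (denq (t n.+1)).
have hd : is_int (d%:R * t n.+1).
  by exists (numq (t n.+1)); rewrite natr_absz gtr0_norm ?denq_gt0// mulrC numqE.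
exists (M * d)%N; first by rewrite muln_gt0 M0 absz_gt0 denq_neq0.
move=> j; rewrite leq_eqVlt ltnS natrM => /orP[/eqP ->|/hM jn].
  by rewrite -mulrA; apply: is_intM => //; exists M.
by rewrite mulrAC mulrC; apply: is_intM => //; exists d.
Qed.

(** Reducing the functional modulo 1 changes its values by integers and makes its
values on the monomials uniformly bounded. *)
Lemma character_index (G : set {poly int}) (t : nat -> rat) (v : {poly int}) :
  (forall P, G P -> is_int (pairing P t N.+1)) -> ~ is_int (pairing v t N.+1) ->
  exists2 i, admissible G (character_of i) & ~ is_int (pairing v (character_of i) N.+1).
Proof.
move=> Gt vt; pose fr j := t j - (Num.floor (t j))%:~R.
exists (choice.pickle (mkseq fr N.+1)).
all: rewrite /character_of choice.pickleK.
all: have pE P : exists k : int, pairing P (nth 0 (mkseq fr N.+1)) N.+1 = pairing P t N.+1 - k%:~R.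
1,3: exists (\sum_(j < N.+1) P`_j * Num.floor (t j)).
1,2: rewrite rmorph_sum -sumrB; apply: eq_bigr => j _.
1,2: by rewrite nth_mkseq// /fr mulrBr rmorphM.
- split=> [j|P /Gt h]; last first.
    by have [k ->] := pE P; apply: is_intD => //; apply: is_intN; exists k.
  have [jN|Nj] := ltnP j N.+1; last by rewrite nth_default ?size_mkseq// lexx ler01.
  rewrite nth_mkseq// /fr subr_ge0 floor_le/= lerBlDl.
  by rewrite -[X in _ + X]/(1%:~R) -intrD ltW// floorD1_gt.
- move=> h; apply: vt; have [k hk] := pE v.
  rewrite -[pairing v t N.+1](subrK k%:~R) -hk; apply: is_intD => //; by exists k.
Qed.

End Characters.

Section Rigidity.
Variables (R : realType) (K : numClosedFieldType) (c : real_form R K).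
Variables (N : nat) (N0 : (0 < N)%N) (G : set {poly int}).
Hypothesis GN : G `<=` polys_le N.
Hypothesis sG : subgroup G.

Local Notation lacunary := (lacunary N).
Local Notation E := walsh_exhaustion.
Local Notation H := (ell2_hilbert c E).

(** On the summands whose code is not that of an admissible functional the operator is
the identity. *)
Definition rigid_phases l (x : walsh_index) : R :=
  if `[< admissible N G (character_of x.1) >] then angle N R (character_of x.1) l else 0.

Lemma rigid_phases_invariant : flip_invariant walsh_flip rigid_phases.
Proof. by []. Qed.

Lemma rigid_phases_rapid : rapid c rigid_phases.
Proof.
exists (c (pi *+ 4 * N%:R)) => [|l x].
  by rewrite ofreal_ge0 mulr_ge0// mulrn_wge0// pi_ge0.
apply: le_trans (phase_lipschitz c _) _.
rewrite -(rmorph_nat c 2) -fmorphV -rmorphXn -rmorphM/= ofreal_le -mulrA.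
rewrite ler_wpM2l ?(mulrn_wge0 4 (pi_ge0 R))// /rigid_phases.
case: asboolP => [[t01 _]|_]; last by rewrite normr0 mulr_ge0// exprn_ge0// invr_ge0.
apply: le_trans (angle_le N R t01 l) _; rewrite ler_wpM2l// exprVn lef_pV2 ?posrE ?exprn_gt0//.
  rewrite -natrX ler_nat; apply: leq_trans (lacunary_growth N0 l).
  by rewrite leq_pmull// expn_gt0.
by rewrite ltr0n lacunary_gt0.
Qed.

Definition rigid_good := GoodPhases rigid_phases_invariant rigid_phases_rapid.

Definition rigid_unitary : unitary H :=
  inf_prod_unitary walsh_flipK walsh_flipC walsh_flip_box rigid_good.

Variable p : set_system posnat.
Hypothesis pU : UltraFilter p.
Hypothesis pB : block_filter N `<=` p.

Lemma p_block L : p (block N L).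
Proof. by apply: pB; exists L. Qed.

Lemma rigid_in (P : {poly int}) : G P ->
  forall u : H, (fun n : posnat => unitary_pow rigid_unitary P.[(sval n)%:Z] u) @ p --> u.
Proof.
move=> GP; have pp := @ultra_proper _ _ pU; apply: strong_cvg_delta.
  by move=> n u; exact: unitary_pow_norm.
move=> x; have [P0 sP] := GN GP.
apply/cvgrPdist_le => e e0.
suff [L hL] : exists L, forall n, block N L n ->
    `|unitary_pow rigid_unitary P.[(sval n)%:Z] (edelta c E x) - edelta c E x| <= e.
  by apply: filterS (p_block L) => n /hL; rewrite distrC.
have [adm|nadm] := pselect (admissible N G (character_of x.1)); last first.
  exists 0%N => n _; apply: unitary_pow_near => m; rewrite big1 ?ltW// => l _.
  by rewrite /= /rigid_phases asboolF// mulr0 phase0 subrr normr0.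
have [t01 Gt] := adm; have [M M0 Mt] := common_denominator N (character_of x.1).
pose D : K := c (pi *+ 4 * poly_bound N R P).
have D0 : 0 <= D by rewrite ofreal_ge0 mulr_ge0 ?poly_bound_ge0// mulrn_wge0// pi_ge0.
have [|L0 hL0] := @half_pow_lt R K c (2 * D) e _ e0; first by rewrite mulr_ge0.
(* L0 controls the tail of the errors, M the divisibility by the denominators. *)
exists (maxn L0 M) => n [D' [F nDF]].
apply: unitary_pow_near => m.
apply: le_trans (ltW (hL0 _ (leq_maxl L0 M))).
pose f l := `|phase c (P.[(sval n)%:Z]%:~R * rigid_good l x) - 1|.
apply: (geometric_sum_le (f := f) m D0); rewrite /f.
  move=> l lL; rewrite /= /rigid_phases asboolT//.
  have := block_estimate_low N0 R M0 Mt sP P0 nDF (leq_maxr L0 M) lL.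
  move=> /(phase_near_int c); rewrite mulr0 rmorph0 normr_le0 => /eqP ->.
  by rewrite normr0.
move=> l; rewrite /= /rigid_phases asboolT//.
have := block_estimate N0 R t01 M0 Mt sP P0 l nDF (leq_maxr L0 M).
have [k ->] := Gt P GP; rewrite ratr_int => h.
have {}h : near_int ((P.[(sval n)%:Z])%:~R * angle N R (character_of x.1) l)
    (poly_bound N R P * 2^-1 ^+ l).
  have := near_intD h (near_int_int R ((F l : nat)%:Z * k)).
  have -> : ((F l : nat)%:Z * k)%:~R = (F l)%:R * k%:~R :> R by rewrite rmorphM.
  by rewrite addr0 subrK.
apply: le_trans (phase_near_int c h) _.
by rewrite mulrA rmorphM rmorphXn fmorphV rmorph_nat.
Qed.

Lemma rigid_out (P : {poly int}) : polys_le N P -> ~ G P ->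
  ~ (forall u v : H, (fun n : posnat => hdot (unitary_pow rigid_unitary P.[(sval n)%:Z] u) v) @ p
       --> hdot u v).
Proof.
move=> [P0 sP] GP hcvg; have pp := @ultra_proper _ _ pU.
have [|t [Gt Pt]] := @separation N.+1 G P sG _ sP GP.
  by move=> Q /GN[].
have [i adm nint] := character_index Gt Pt.
have [t01 _] := adm; have [M M0 Mt] := common_denominator N (character_of i).
pose s : R := ratr (pairing P (character_of i) N.+1).
pose z := phase c s.
have z1 : `|z| = 1 by exact: phase_norm.
have zn1 : z != 1.
  apply/eqP => /phase_eq1[k sk]; apply: nint; exists k.
  by apply: (fmorph_inj (ratr : {rmorphism rat -> R})); rewrite /= -/s sk ratr_int.
have rho1 := halfsum_lt1 z1 zn1.
pose D : K := c (pi *+ 4 * poly_bound N R P).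
have D0 : 0 <= D by rewrite ofreal_ge0 mulr_ge0 ?poly_bound_ge0// mulrn_wge0// pi_ge0.
pose e := (1 - `|halfsum z|) / 2.
have e0 : 0 < e by rewrite divr_gt0// subr_gt0.
have [L0 hL0] := @half_pow_lt R K c D e D0 e0.
pose x : walsh_index := (i, fset0).
pose Ud (n : posnat) := unitary_pow rigid_unitary P.[(sval n)%:Z] (edelta c E x).
have coefE (u : H) : hdot u (edelta c E x) = u x by exact: edot_delta.
have bound n : block N (maxn L0 M) n -> `|Ud n x| <= 1 - e.
  move=> [D' [F nDF]].
  (* A single factor of the product already bounds it away from 1. *)
  have [l Fl] : exists l, F l.
    apply: contrapT => noF; have := svalP n; have [_ ->] := nDF.
    by rewrite sumn_empty// => k _; apply/negP => Fk; apply: noF; exists k.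
  have /andP[Ll _] := nDF.1 _ Fl.
  have hc := @unitary_pow_coef R K c _ E _ walsh_flipK walsh_flipC walsh_flip_box
    rigid_good P.[(sval n)%:Z] x l (@walsh_flip_fresh i).
  apply: le_trans hc _.
  rewrite /= /rigid_phases asboolT//.
  have := block_estimate N0 R t01 M0 Mt sP P0 l nDF (leq_maxr L0 M).
  rewrite Fl mul1r -/s => h.
  rewrite -[X in phase c X](subrKC s) phaseD.
  apply: le_trans (halfsum_near _ z1) _.
  have -> : 1 - e = `|halfsum z| + e by rewrite /e; field.
  rewrite lerD2l; apply: le_trans (phase_near_int c h) _.
  apply: le_trans (ltW (hL0 l _)); last by apply: leq_trans Ll; exact: leq_maxl.
  by rewrite mulrA rmorphM rmorphXn fmorphV rmorph_nat.
have h1 : (fun n : posnat => `|Ud n x|) @ p --> (1 : K).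
  have := hcvg (edelta c E x) (edelta c E x).
  rewrite coefE edeltaE eqxx.
  have -> : (fun n : posnat => hdot (Ud n) (edelta c E x)) =
    (fun n : posnat => Ud n x).
    by apply/funext => n; rewrite coefE.
  by rewrite -[X in _ -> _ --> X](@normr1 K) => /cvg_norm.
have : 1 <= 1 - e.
  apply: (complex_cvg_le c _ h1); apply: filterS (p_block _) => n; exact: bound.
by rewrite lerBrDr gerDl => /(lt_le_trans e0); rewrite ltxx.
Qed.

End Rigidity.

Theorem rigidity_group (R : realType) (K : numClosedFieldType) (c : real_form R K)
    (N : nat) (N0 : (0 < N)%N) (G : set {poly int}) (GN : G `<=` polys_le N)
    (sG : subgroup G) :
  exists (H : hilbertType K) (U : unitary H) (p : set_system posnat),
    [/\ separable H, UltraFilter p, uf_add p p = p &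
        G = [set P | polys_le N P /\
               (fun n : posnat => unitary_pow U P.[(sval n)%:Z] : wot H) @ p
                 --> (bop_id : wot H)]].
Proof.
have [p [pU pB pp]] := idempotent_ultrafilter (block_filter_subsemigroup N).
have pF := @ultra_proper _ _ pU.
exists (ell2_hilbert c walsh_exhaustion), (rigid_unitary c N0 G), p; split=> //.
  exact: ell2_separable.
apply/seteqP; split=> P.
  move=> GP; split; first exact: GN.
  apply/wot_cvgP => u v; have hin := rigid_in (c := c) N0 GN pU pB GP (u := u).
  have hd := @hdot_cvgl _ _ _ _ _ _ _ v hin; exact: hd.
move=> [PN /wot_cvgP h]; apply: contrapT => nGP.
exact: (rigid_out (c := c) (N0 := N0) GN sG pU pB PN nGP h).
Qed.

Theorem theoremG (R : realType) (N : nat) (hN : (0 < N)%N)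
    (G : set {poly int}) (hGN : G `<=` polys_le N)
    (hG : zmod_closed [in G]) :
  exists (H : hilbertType R[i]) (U : unitary H) (p : set_system posnat),
    [/\ separable H, UltraFilter p, uf_add p p = p &
        G = [set P | polys_le N P /\
               (fun n : posnat => unitary_pow U P.[(sval n)%:Z] : wot H) @ p
                 --> (bop_id : wot H)]].
Proof.
apply: (rigidity_group (complex_real_form R) hN hGN).
have [G0 GB] := hG; split; first exact/set_mem.
by move=> P Q GP GQ; apply/set_mem/GB; exact/mem_set.
Qed.
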